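(* Let $\mathbf A$ be an Artin–Tits monoid. Then the graded Möbius transform $\mathrm T$ and the inverse graded Möbius transform $\mathrm T^\ast$ are two endomorphisms, inverse of each other, of the real vector space of all functions $\mathbf A\to\mathbb R$.
   Context: Let $\Sigma$ be a finite non-empty set and $\ell:\Sigma\times\Sigma\to\{2,3,\dots\}\cup\{\infty\}$ a symmetric function. The Artin–Tits monoid $\mathbf A=\mathbf A(\Sigma,\ell)$ is the monoid presented by the generators $\Sigma$ and the relations $abab\cdots=baba\cdots$ (both alternating words of length $\ell(a,b)$) for all $a\neq b$ with $\ell(a,b)<\infty$. Its unit is $\mathbf e$. Put $x\leq_{\mathrm l}y$ iff $y=x\cdot z$ for some $z\in\mathbf A$, and $x\leq_{\mathrm r}y$ iff $y=z\cdot x$ for some $z\in\mathbf A$ (both are partial orders). $\bigvee X$ denotes the least upper bound of $X$ for $\leq_{\mathrm l}$ when it exists ($\bigvee\emptyset=\mathbf e$), and $a\vee b=\bigvee\{a,b\}$. A Garside subset of $\mathbf A$ is a subset containing $\Sigma$, closed under existing $\vee$ (if $a,b$ belong to it and $a\vee b$ exists in $\mathbf A$ then $a\vee b$ belongs to it), and downward closed under $\leq_{\mathrm r}$. There is a smallest Garside subset $\mathcal S$; it is finite and contains $\Sigma\cup\{\mathbf e\}$. For $x,y\in\mathcal S$ write $x\to y$ if $x=\bigvee\{\zeta\in\mathcal S:\zeta\leq_{\mathrm l}x\cdot y\}$. Every $x\neq\mathbf e$ writes uniquely as $x=x_1\cdots x_k$ with $k\geq1$, $x_i\in\mathcal S\setminus\{\mathbf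 e\}$ and $x_1\to x_2\to\dots\to x_k$; $(x_1,\dots,x_k)$ is the normal form of $x$ and $\tau(x)=k$ its height. The normal form of $\mathbf e$ is $(\mathbf e)$, so $\tau(\mathbf e)=1$. For $x\in\mathbf A$, let $\mathcal E(x)=\{u\in\mathbf A:\tau(x\cdot u)\leq\tau(x)\}\setminus\{\mathbf e\}$ and let $\mathcal D(x)$ be the set of $\leq_{\mathrm l}$-minimal elements of $\mathcal E(x)$ (a finite set). Let $\mathbf A[x]$ be the (finite) set of all $y\in\mathbf A$ with $x\leq_{\mathrm l}y$ such that, if $(y_1,\dots,y_k)$ is the normal form of $y$, then $x\leq_{\mathrm l}y_1\cdots y_j$ holds for no $j$ with $1\leq j<k$. The graded Möbius transform of $f:\mathbf A\to\mathbb R$ is $\mathrm Tf(x)=\sum_{D}(-1)^{|D|}f\bigl(x\cdot\bigvee D\bigr)$, the sum being over all subsets $D\subseteq\mathcal D(x)$ such that $\bigvee D$ exists in $\mathbf A$ (including $D=\emptyset$). The inverse graded Möbius transform of $h:\mathbf A\to\mathbb R$ is $\mathrm T^\ast h(x)=\sum_{y\in\mathbf A[x]}h(y)$. *)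

(* Defs.v *)
From HB Require Import structures.
From mathcomp Require Import all_boot all_order all_algebra finmap.
From mathcomp Require Import all_classical all_reals.

Set Implicit Arguments.
Unset Strict Implicit.
Unset Printing Implicit Defensive.

Local Open Scope classical_set_scope.
Local Open Scope group_scope.

(* A labelling is a function ell : Sigma -> Sigma -> option nat, where None
   stands for the value infinity. *)

Section ArtinTitsMonoid.
Context (Sigma : finType) (ell : Sigma -> Sigma -> option nat).

Definition alternating (a b : Sigma) (n : nat) : seq Sigma :=
  mkseq (fun i => if odd i then b else a) n.

Inductive braid_eq : seq Sigma -> seq Sigma -> Prop :=
| braid_rel (a b : Sigma) (n : nat) (u v : seq Sigma) :
    a != b -> ell a b = Some n ->
    braid_eq (u ++ alternating a b n ++ v) (u ++ alternating b a n ++ v)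
| braid_refl u : braid_eq u u
| braid_sym u v : braid_eq u v -> braid_eq v u
| braid_trans u v w : braid_eq u v -> braid_eq v w -> braid_eq u w.

Definition braid_eqb (u v : seq Sigma) : bool := `[< braid_eq u v >].

Lemma braid_eqb_refl : reflexive braid_eqb.
Proof. by move=> u; apply/asboolP/braid_refl. Qed.

Lemma braid_eqb_sym : symmetric braid_eqb.
Proof. by move=> u v; apply/asboolP/asboolP => /braid_sym. Qed.

Lemma braid_eqb_trans : transitive braid_eqb.
Proof.
by move=> v u w /asboolP uv /asboolP vw; apply/asboolP/(braid_trans uv vw).
Qed.

Canonical braid_equiv :=
  EquivRel braid_eqb braid_eqb_refl braid_eqb_sym braid_eqb_trans.

Definition artin_tits : Type := {eq_quot braid_equiv}%qT.

HB.instance Definition _ := EqQuotient.on artin_tits.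
HB.instance Definition _ := Choice.on artin_tits.

Definition word_class (w : seq Sigma) : artin_tits := (\pi_artin_tits w)%qT.

Definition word_repr (x : artin_tits) : seq Sigma := repr x.

Lemma word_reprK : cancel word_repr word_class.
Proof. by move=> x; apply: reprK. Qed.

Lemma word_classP u v : word_class u = word_class v <-> braid_eq u v.
Proof. by split=> [/eqmodP/asboolP|uv] //; apply/eqmodP/asboolP. Qed.

Lemma braid_eq_catl u v w : braid_eq u v -> braid_eq (w ++ u) (w ++ v).
Proof.
elim=> [a b n u' v' nab lab|u'|u' v' _ IH|u' v' w' _ IH1 _ IH2].
- by rewrite !(catA w); apply: braid_rel.
- exact: braid_refl.
- exact: braid_sym.
- exact: braid_trans IH1 IH2.
Qed.

Lemma braid_eq_catr u v w : braid_eq u v -> braid_eq (u ++ w) (v ++ w).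
Proof.
elim=> [a b n u' v' nab lab|u'|u' v' _ IH|u' v' w' _ IH1 _ IH2].
- by rewrite -!catA; apply: braid_rel.
- exact: braid_refl.
- exact: braid_sym.
- exact: braid_trans IH1 IH2.
Qed.

Definition at_mul (x y : artin_tits) : artin_tits :=
  word_class (word_repr x ++ word_repr y).

Definition at_one : artin_tits := word_class [::].

Lemma at_mulE u v : at_mul (word_class u) (word_class v) = word_class (u ++ v).
Proof.
have rK w : braid_eq (word_repr (word_class w)) w.
  by apply/word_classP; rewrite word_reprK.
apply/word_classP; apply: braid_trans (braid_eq_catr _ (rK u)) _.
exact/braid_eq_catl/rK.
Qed.

Lemma at_mulA : associative at_mul.
Proof.
move=> x y z; rewrite -(word_reprK x) -(word_reprK y) -(word_reprK z).
by rewrite !at_mulE catA.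
Qed.

Lemma at_mul1 : left_id at_one at_mul.
Proof. by move=> x; rewrite -(word_reprK x) at_mulE. Qed.

Lemma at_1mul : right_id at_one at_mul.
Proof. by move=> x; rewrite -(word_reprK x) at_mulE cats0. Qed.

HB.instance Definition _ := isMonoid.Build artin_tits at_mulA at_mul1 at_1mul.

Definition at_gen (a : Sigma) : artin_tits := word_class [:: a].

End ArtinTitsMonoid.

Section Divisibility.
Context (A : monoidType).

Definition lediv_l (x y : A) : Prop := exists z, y = x * z.
Definition lediv_r (x y : A) : Prop := exists z, y = z * x.

Definition is_join (X : set A) (m : A) : Prop :=
  (forall x, X x -> lediv_l x m) /\
  (forall m', (forall x, X x -> lediv_l x m') -> lediv_l m m').

Definition has_join (X : set A) : Prop := exists m, is_join X m.

(* Equal to 1 by convention when X has no least upper bound. *)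
Definition join (X : set A) : A := xget 1 [set m | is_join X m].

End Divisibility.

Section Moebius.
Context (Sigma : finType) (ell : Sigma -> Sigma -> option nat).
Local Notation A := (artin_tits ell).

Definition garside_subset (G : set A) : Prop :=
  [/\ forall a, G (at_gen ell a),
      forall x y m, G x -> G y -> is_join [set x; y] m -> G m
    & forall x y, lediv_r x y -> G y -> G x].

(* The three closure conditions are stable under intersection, so this is the
   smallest Garside subset. *)
Definition garside_S : set A := \bigcap_(G in garside_subset) G.

Definition nf_arrow (x y : A) : Prop :=
  is_join [set z | garside_S z /\ lediv_l z (x * y)] x.

Definition is_normal_form (x : A) (s : seq A) : Prop :=
  if x == 1 then s = [:: 1] else
  [/\ (0 < size s)%N, x = \prod_(z <- s) z,
      forall z, z \in s -> garside_S z /\ z <> 1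
    & sorted (fun y z => `[< nf_arrow y z >]) s].

Definition normal_form (x : A) : seq A := xget [::] [set s | is_normal_form x s].

Definition height (x : A) : nat := size (normal_form x).

Definition expanders (x : A) : set A :=
  [set u | (height (x * u)%g <= height x)%N /\ u <> 1].

Definition min_expanders (x : A) : set A :=
  [set u | expanders x u /\
           forall v, expanders x v -> lediv_l v u -> v = u].

Definition graded_multiples (x : A) : set A :=
  [set y | lediv_l x y /\
           forall j, (1 <= j < height y)%N ->
             ~ lediv_l x (\prod_(z <- take j (normal_form y)) z)].

Section Transforms.
Context (R : realType).
Local Open Scope ring_scope.

(* The sums below are sums of finitely supported families; the subsets D of
   the finite set min_expanders x are exactly its finite subsets. *)
Definition moebius (f : A -> R^o) : A -> R^o := fun x =>
  \sum_(D \in [set D : {fset A} |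
                 [set` D] `<=` min_expanders x /\ has_join [set` D]])
    (-1) ^+ #|` D| * f (x * join [set` D])%g.

Definition inv_moebius (h : A -> R^o) : A -> R^o := fun x =>
  \sum_(y \in graded_multiples x) h y.

End Transforms.
End Moebius.

(* Main.v *)
From HB Require Import structures.
From mathcomp Require Import all_boot all_order all_algebra finmap.
From mathcomp Require Import all_classical all_reals.
From mathcomp Require Import zify ring lra.
From mathcomp Require Import trigo.
Require Import Defs.

(** Inversion itself is an inclusion-exclusion. Expanding the transform of the
    inverse transform of [f] at [x], the value [f y] gets the coefficient
    [\sum_D (-1)^|D|] over the sets [D] of minimal expanders of [x] that have a
    join and for which [x * join D] divides [y] but does not divide [y] stripped
    of the last factor of its normal form ([last_cut y]). Unless [y = x], adding
    or removing one well-chosen expander preserves this condition and flips the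
    sign, so the coefficient vanishes ([moebius_coef]). Conversely the Moebius transform is
    unitriangular for divisibility on the finite set of elements of height at
    most [n], hence injective ([moebius_inj]); a right inverse of an injective
    map is a two-sided inverse.

    All of this needs cancellation, joins of bounded families, the calculus of
    normal forms, and above all the finiteness of the smallest Garside subset
    S: the inverse transform at [1] is a sum over the whole of S, so linearity
    already fails if S is infinite. These facts are obtained as follows.

    An element of the monoid is square-free if no word for it repeats a letter
    twice in a row. Square-free elements are the copies in the monoid of the
    elements of the Coxeter group. Acting on the geometric representation they
    detect their last letters through the sign of roots ([ndesc_pos]), the
    action is faithful on them ([sqf_act_inj]), and the exchange property
    follows ([sqf_exchange], [lediv_lift]). This gives bounded joins of
    square-free elements. Following J. Michel, extracting the greatest
    square-free prefix is an action of the monoid on pairs (square-free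
    element, remainder); that this action respects the braid relations yields
    left cancellation ([at_mulI]) and all bounded joins ([at_bounded_join]).

    To bound S, compare square-free elements by the set of left factors [v] for
    which [v * x] stays square-free. A gate is a square-free element none of
    whose proper prefixes has the same set. Gates are closed under suffixes for
    formal reasons, and under joins because a top edge of a rank-two polygon of
    the weak order that leaves this set unchanged forces the same along the
    opposite chain ([polygon_forcing], [lmult_sub_meet]). So S consists of
    gates. Let the right cone of [v] be the set of [z] with [v * z] square-free.
    A gate is determined by those of its prefixes that are least elements of the
    difference of two right cones ([gate_le]). Hence there are finitely many gates
    once there are finitely many right cones ([finite_gate]).

    The right cone of [v] is determined by the small roots (those dominating no
    other positive root) that [v] makes negative ([right_cone_small]), and there
    are finitely many small roots, by the theorem of Brink and Howlett
    ([finite_small]). Its proof lowers a small root step by step to a simple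
    one. The products of the successive roots with the simple roots, truncated
    at -1, take finitely many values, because two roots with product strictly
    between -1 and 1 are conjugate into a finite parabolic subsystem
    ([form_value_root]); and two roots of one descent with the same truncated
    products would have product 1, which small roots exclude. *)

Set Implicit Arguments.
Unset Strict Implicit.
Unset Printing Implicit Defensive.

Import Order.TTheory GRing.Theory Num.Theory.
Local Open Scope classical_set_scope.

(** * Chebyshev values at the angles of the representation *)
Section Chebyshev.
Local Open Scope ring_scope.
Context (R : realType).
Implicit Types (c : R) (k : nat).

(** The value at [c] of the Chebyshev polynomial of the second kind of degree
    [k - 1]: with [c = cos t] it is [sin (k t) / sin t], and the pair of
    consecutive terms is what the iteration carries. *)
Definition cheb c k : R := (iter k (fun p => (p.2, 2 * c * p.2 - p.1)) (0, 1)).1.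

Lemma cheb0 c : cheb c 0 = 0. Proof. by []. Qed.
Lemma cheb1 c : cheb c 1 = 1. Proof. by []. Qed.
Lemma chebSS c k : cheb c k.+2 = 2 * c * cheb c k.+1 - cheb c k.
Proof. by []. Qed.

Lemma cheb_sin (t : R) k : sin t * cheb (cos t) k = sin (k%:R * t).
Proof.
suff [] : sin t * cheb (cos t) k = sin (k%:R * t) /\
   sin t * cheb (cos t) k.+1 = sin (k.+1%:R * t) by [].
elim: k => [|k [IH1 IH2]]; first by rewrite cheb0 cheb1 mul0r sin0 mulr0 mulr1 mul1r.
split => //; rewrite chebSS mulrBr IH1 mulrCA IH2.
have -> : k.+2%:R * t = k.+1%:R * t + t by rewrite -natr1; ring.
have -> : k%:R * t = k.+1%:R * t - t by rewrite -natr1; ring.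
rewrite sinB sinD; ring.
Qed.

Lemma cheb_one k : cheb 1 k = k%:R.
Proof.
suff [] : cheb 1 k = k%:R /\ cheb 1 k.+1 = k.+1%:R by [].
elim: k => [|k [IH1 IH2]]; first by rewrite cheb0 cheb1.
split => //; rewrite chebSS IH1 IH2 -(natr1 k.+1) -(natr1 k); ring.
Qed.

Section Angle.
Context (m : nat) (m2 : (2 <= m)%N).
Local Notation t := (pi / m%:R : R).

Let m0 : (0 : R) < m%:R. Proof. by rewrite ltr0n; lia. Qed.

Lemma sin_angle_gt0 : 0 < sin t.
Proof.
apply/sin_gt0_pi/andP; split; first by rewrite divr_gt0 ?pi_gt0.
by rewrite ltr_pdivrMr // ltr_pMr ?pi_gt0 // ltr1n.
Qed.

Lemma cheb_angle_ge0 k : (k <= m)%N -> 0 <= cheb (cos t) k.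
Proof.
move=> km; rewrite -(pmulr_rge0 _ sin_angle_gt0) cheb_sin.
apply/sin_ge0_pi/andP; split; first by rewrite mulr_ge0 // divr_ge0 ?pi_ge0.
rewrite mulrCA ler_piMr ?pi_ge0 // ler_pdivrMr // mul1r ler_nat //.
Qed.

Lemma cheb_angle_m : cheb (cos t) m = 0.
Proof.
apply: (mulfI (lt0r_neq0 sin_angle_gt0)); rewrite cheb_sin mulr0.
by rewrite mulrC mulfVK ?sinpi // lt0r_neq0.
Qed.

Lemma cheb_angle_m1 : cheb (cos t) m.-1 = 1.
Proof.
apply: (mulfI (lt0r_neq0 sin_angle_gt0)); rewrite cheb_sin mulr1.
have -> : m.-1%:R * t = - t + pi.
  rewrite -subn1 natrB; last by lia.
  by rewrite mulrBl mulrC mulfVK ?lt0r_neq0 // mul1r addrC.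
by rewrite sinDpi sinN opprK.
Qed.

End Angle.
End Chebyshev.

(** * Finite sets and a rotating sequence *)
Section Auxiliary.
Local Open Scope ring_scope.

Lemma finite_no_injection (T : choiceType) (F : set T) (f : nat -> T) :
  finite_set F -> (forall i, F (f i)) -> injective f -> False.
Proof.
move=> fF Ff finj; pose s := fset_set F.
have : (size [seq f i | i <- iota 0 (size s).+1] <= size s)%N.
  apply: uniq_leq_size; first by rewrite map_inj_uniq ?iota_uniq.
  by move=> _ /mapP [i _ ->]; rewrite /s in_fset_set // inE.
by rewrite size_map size_iota ltnn.
Qed.

(** The recurrence is that of a coordinate of a point turned by a fixed
    rotation. As long as the terms are positive, the ratio of consecutive terms
    is less than 2 after one step and then drops by at least [2 - 2 b] at every
    step, so the bound on [k] does not depend on the initial values. *)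
Lemma rotation_sequence_nonpos (R : realType) (b : R) : b < 1 -> exists K : nat, forall x : nat -> R,
  (forall k, x k.+2 = 2 * b * x k.+1 - x k) -> exists2 k, (k <= K)%N & x k <= 0.
Proof.
move=> b1; pose e := 2 - 2 * b.
have e0 : 0 < e by rewrite /e; lra.
pose j := Num.bound (2 / e).
have je : 2 <= j%:R * e.
  have := @archi_boundP R (2 / e) (divr_ge0 (ler0n _ 2) (ltW e0)).
  by rewrite ltr_pdivrMr // => /ltW.
exists j.+2 => x xE; apply: contrapT => nx.
have xpos k : (k <= j.+2)%N -> 0 < x k.
  by move=> kK; rewrite ltNge; apply/negP => xk; apply: nx; exists k.
have claim i : (i <= j)%N -> x i.+2 <= (2 - i%:R * e) * x i.+1.
  elim: i => [|i IH] ij.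
    rewrite mul0r subr0 xE; have := xpos 0%N isT; have := xpos 1%N isT.
    by move=> x1 x0; nra.
  have := IH (ltnW ij).
  have p1 : 0 < x i.+1 by apply: xpos; lia.
  have p2 : 0 < x i.+2 by apply: xpos; lia.
  have u0 : 0 <= i%:R * e by rewrite mulr_ge0 // ltW.
  have -> : i.+1%:R * e = i%:R * e + e by rewrite -natr1 mulrDl mul1r.
  rewrite (xE i.+1); move: (i%:R * e) u0 => u u0 le.
  have h1 : 0 <= u * ((2 - u) * x i.+1 - x i.+2) by rewrite mulr_ge0 // subr_ge0.
  have h2 : 0 <= (1 - u) ^+ 2 * x i.+1 by rewrite mulr_ge0 ?sqr_ge0 // ltW.
  rewrite -subr_ge0; apply: le_trans (addr_ge0 h1 h2) _.
  by rewrite le_eqVlt; apply/orP; left; apply/eqP; rewrite /e; ring.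
have := claim j (leqnn j); have := xpos j.+2 (leqnn _).
have := xpos j.+1 (leqnSn _) => p q le.
have : x j.+2 <= 0 by apply: le_trans le _; apply: mulr_le0_ge0; [lra|exact: ltW].
by move: q; rewrite ltNge => /negP.
Qed.

Lemma finite_powerset (T : choiceType) (X : set T) : finite_set X ->
  finite_set [set Z | Z `<=` X].
Proof.
move=> fX; apply: (@sub_finite_set _ _
  ((fun F : {fset T} => [set` F]) @` [set` fpowerset (fset_set X)])); last first.
  by apply: finite_image; apply: finite_fset.
move=> Z ZX; have fZ := sub_finite_set ZX fX.
exists (fset_set Z); last exact: fset_setK.
rewrite /= fpowersetE; apply/fsubsetP => z.
by rewrite !in_fset_set // !inE => /ZX.
Qed.

End Auxiliary.

(** * Signed sums over the subsets of a finite set *)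
Section Toggle.
Local Open Scope ring_scope.
Local Open Scope fset_scope.
Context (R : realType) (T : choiceType).
Implicit Types (D E : {fset T}) (e : T).

Definition toggle e D : {fset T} := if e \in D then D `\ e else e |` D.

Lemma toggleK e : involutive (toggle e).
Proof.
move=> D; rewrite /toggle; case: (boolP (e \in D)) => eD.
  by rewrite in_fsetD1 eqxx fsetD1K.
by rewrite in_fset1U eqxx fsetU1K.
Qed.

Lemma sign_toggle e D : (-1) ^+ #|` toggle e D| = - (-1) ^+ #|` D| :> R.
Proof.
rewrite /toggle; case: (boolP (e \in D)) => eD.
  by rewrite (cardfsD1 e D) eD exprS mulN1r opprK.
by rewrite cardfsU1 eD exprS mulN1r.
Qed.

Lemma toggle_fpowerset e D E : e \in E -> (toggle e D \in fpowerset E) = (D \in fpowerset E).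
Proof.
move=> eE; have sub D' : D' \in fpowerset E -> toggle e D' \in fpowerset E.
  rewrite !fpowersetE /toggle => D'E; case: ifP => _.
    exact: fsubset_trans (fsubD1set _ _) D'E.
  by rewrite fsubUset fsub1set eE.
by apply/idP/idP => [/sub|/sub //]; rewrite toggleK.
Qed.

(** Toggling [e] is an involution of the index set that flips every sign. *)
Lemma sum_sign_toggle e E (Q : pred {fset T}) : e \in E ->
  (forall D, D \in fpowerset E -> Q (toggle e D) = Q D) ->
  \sum_(D <- fpowerset E | Q D) (-1) ^+ #|` D| = 0 :> R.
Proof.
move=> eE QE; set s := \sum_(D <- _ | _) _.
suff sN : s = - s by lra.
rewrite /s -sumrN.
have pE : perm_eq (fpowerset E) [seq toggle e D | D <- fpowerset E].
  apply: uniq_perm => //; first by rewrite map_inj_uniq ?fset_uniq //; apply: inv_inj; apply: toggleK.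
  move=> D; rewrite -{2}[D](toggleK e) mem_map ?toggle_fpowerset //.
  by apply: inv_inj; apply: toggleK.
rewrite (perm_big _ pE) big_map big_seq_cond [RHS]big_seq_cond.
apply: eq_big => D; last by rewrite sign_toggle.
by case: (boolP (D \in _)) => //= /QE.
Qed.

End Toggle.

Section ArtinTits.
Context (R : realType) (Sigma : finType) (ell : Sigma -> Sigma -> option nat).
Context (Sigma_nonempty : (0 < #|Sigma|)%N).
Context (ell_sym : forall a b, ell a b = ell b a).
Context (ell_ge2 : forall a b n, ell a b = Some n -> (2 <= n)%N).
Local Notation A := (artin_tits ell).
Local Notation V := {ffun Sigma -> R^o}.
Local Notation gen := (at_gen ell).
Local Notation cls := (@word_class Sigma ell).

(** * Words, length and reversal *)
Section Words.
Local Open Scope group_scope.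
Implicit Types (a b s t : Sigma) (u v w : seq Sigma) (x y z : A) (n k : nat).

Lemma at_mulgE u v : cls u * cls v = cls (u ++ v).
Proof. exact: at_mulE. Qed.

Lemma at_class_cons s u : cls (s :: u) = gen s * cls u.
Proof. by rewrite at_mulgE. Qed.

Lemma at_class_rcons s u : cls (rcons u s) = cls u * gen s.
Proof. by rewrite at_mulgE cats1. Qed.

Lemma at_class_nil : cls [::] = 1.
Proof. by []. Qed.

Lemma at_class_surj x : exists u, x = cls u.
Proof. by exists (word_repr x); rewrite word_reprK. Qed.

Lemma braid_eq_repr u : braid_eq ell (word_repr (cls u)) u.
Proof. by apply/word_classP; rewrite word_reprK. Qed.

Lemma at_lift_class (T : Type) (f : seq Sigma -> T) u :
  (forall v w, braid_eq ell v w -> f v = f w) -> f (word_repr (cls u)) = f u.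
Proof. by move=> fE; apply/fE/braid_eq_repr. Qed.

Lemma size_alternating a b n : size (alternating a b n) = n.
Proof. exact: size_mkseq. Qed.

Lemma alternatingS a b n : alternating a b n.+1 = a :: alternating b a n.
Proof.
rewrite /alternating /mkseq /= -(addn0 1%N) iotaDl -map_comp; congr (_ :: _).
by apply: eq_map => i /=; case: odd.
Qed.

Lemma alternating_rcons a b n :
  alternating a b n.+1 = rcons (alternating a b n) (if odd n then b else a).
Proof. by rewrite /alternating mkseqS. Qed.

Lemma rev_alternating a b n : rev (alternating a b n) =
  if odd n then alternating a b n else alternating b a n.
Proof.
elim: n a b => [|n IH] a b //; rewrite [in LHS]alternatingS rev_cons IH /=.
by case: ifP => on /=; rewrite alternating_rcons on.
Qed.

Lemma alternating_catl a b n k : exists e f,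
  alternating a b (n + k) = alternating a b n ++ alternating e f k /\
  (e = a /\ f = b \/ e = b /\ f = a).
Proof.
elim: n a b => [|n IH] a b; first by exists a, b; split=> //; left.
have [e [f [E d]]] := IH b a; exists e, f; rewrite addSn !alternatingS E; split=> //.
by case: d; [right|left].
Qed.

Lemma braid_eq_size u v : braid_eq ell u v -> size u = size v.
Proof. by elim=> // [a b n u' v' *|*]; rewrite ?size_cat ?size_alternating //; lia. Qed.

Definition at_len x := size (word_repr x).

Lemma at_len_class u : at_len (cls u) = size u.
Proof. by apply: at_lift_class => v w; apply: braid_eq_size. Qed.

Lemma at_lenM x y : at_len (x * y) = (at_len x + at_len y)%N.
Proof.
have [[u ->] [v ->]] := (at_class_surj x, at_class_surj y).
by rewrite at_mulgE !at_len_class size_cat.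
Qed.

Lemma at_len1 : at_len 1 = 0%N. Proof. exact: at_len_class. Qed.

Lemma at_len_gen s : at_len (gen s) = 1%N. Proof. exact: at_len_class. Qed.

Lemma at_len_eq0 x : at_len x = 0%N -> x = 1.
Proof. by have [[|s u] ->] := at_class_surj x; rewrite at_len_class. Qed.

Lemma at_casel x : x = 1 \/ exists s y, x = gen s * y.
Proof.
have [[|s u] ->] := at_class_surj x; first by left.
by right; exists s, (cls u); rewrite at_class_cons.
Qed.

Lemma at_caser x : x = 1 \/ exists y s, x = y * gen s.
Proof.
have [u ->] := at_class_surj x; case/lastP: u => [|u s]; first by left.
by right; exists (cls u), s; rewrite at_class_rcons.
Qed.

Lemma at_indl (P : A -> Prop) :
  P 1 -> (forall s x, P x -> P (gen s * x)) -> forall x, P x.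
Proof.
move=> P1 PS x; have [u ->] := at_class_surj x.
by elim: u => // s u IH; rewrite at_class_cons; apply: PS.
Qed.

Lemma at_indr (P : A -> Prop) :
  P 1 -> (forall x s, P x -> P (x * gen s)) -> forall x, P x.
Proof.
move=> P1 PS x; have [u ->] := at_class_surj x.
by elim/last_ind: u => // u s IH; rewrite at_class_rcons; apply: PS.
Qed.

Lemma at_mul_eq1 x y : x * y = 1 -> x = 1 /\ y = 1.
Proof.
move=> /(congr1 at_len); rewrite at_lenM at_len1 => xy0.
by split; apply: at_len_eq0; lia.
Qed.

Definition alt a b n : A := cls (alternating a b n).

Lemma alt0 a b : alt a b 0 = 1. Proof. by []. Qed.

Lemma altS a b n : alt a b n.+1 = gen a * alt b a n.
Proof. by rewrite /alt alternatingS at_class_cons. Qed.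

Lemma alt1 a b : alt a b 1 = gen a.
Proof. by rewrite altS alt0 mulg1. Qed.

(** The letter that continues the alternating word of length [n]. *)
Definition nxt a b n := if odd n then b else a.

Lemma altSr a b n : alt a b n.+1 = alt a b n * gen (nxt a b n).
Proof. by rewrite /alt alternating_rcons at_class_rcons. Qed.

Lemma at_len_alt a b n : at_len (alt a b n) = n.
Proof. by rewrite at_len_class size_alternating. Qed.

Lemma alt_braid a b n : a != b -> ell a b = Some n -> alt a b n = alt b a n.
Proof.
move=> nab lab; apply/word_classP.
by have := braid_rel [::] [::] nab lab; rewrite /= !cats0.
Qed.

Lemma alt_split a b n k : exists e f, alt a b (n + k) = alt a b n * alt e f k /\
  (e = a /\ f = b \/ e = b /\ f = a).
Proof.
have [e [f [E d]]] := alternating_catl a b n k.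
by exists e, f; rewrite /alt E -at_mulgE.
Qed.

Lemma lediv_refl x : lediv_l x x. Proof. by exists 1; rewrite mulg1. Qed.

Lemma lediv1 x : lediv_l 1 x. Proof. by exists x; rewrite mul1g. Qed.

Lemma lediv_trans y x z : lediv_l x y -> lediv_l y z -> lediv_l x z.
Proof. by move=> [p ->] [q ->]; exists (p * q); rewrite mulgA. Qed.

Lemma lediv_mulr x y : lediv_l x (x * y). Proof. by exists y. Qed.

Lemma lediv_mul2l z x y : lediv_l x y -> lediv_l (z * x) (z * y).
Proof. by move=> [p ->]; exists p; rewrite mulgA. Qed.

Lemma lediv_len x y : lediv_l x y -> (at_len x <= at_len y)%N.
Proof. by move=> [p ->]; rewrite at_lenM leq_addr. Qed.

Lemma lediv_len_eq x y : lediv_l x y -> (at_len y <= at_len x)%N -> x = y.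
Proof.
move=> [p ->]; rewrite at_lenM => le; rewrite (_ : p = 1) ?mulg1 //.
by apply: at_len_eq0; lia.
Qed.

Lemma lediv_anti x y : lediv_l x y -> lediv_l y x -> x = y.
Proof. by move=> xy yx; apply: lediv_len_eq xy (lediv_len yx). Qed.

Lemma lediv1_eq x : lediv_l x 1 -> x = 1.
Proof. by move=> [y /esym /at_mul_eq1 []]. Qed.

End Words.

Section Reversal.
Local Open Scope group_scope.

Lemma braid_eq_rev u v : braid_eq ell u v -> braid_eq ell (rev u) (rev v).
Proof.
elim=> [a b n u' v' nab lab|u'|u' v' _ IH|u' v' w _ IH1 _ IH2].
- rewrite !rev_cat -!catA !rev_alternating; case: odd.
    exact: braid_rel nab lab.
  by apply: braid_rel; [rewrite eq_sym | rewrite ell_sym].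
- exact: braid_refl.
- exact: braid_sym.
- exact: braid_trans IH1 IH2.
Qed.

Definition at_rev (x : A) : A := cls (rev (word_repr x)).

Lemma at_rev_class u : at_rev (cls u) = cls (rev u).
Proof.
apply: (at_lift_class (f := fun u => cls (rev u))) => v w /braid_eq_rev vw.
exact/word_classP.
Qed.

Lemma at_revK : involutive at_rev.
Proof. by move=> x; have [u ->] := at_class_surj x; rewrite !at_rev_class revK. Qed.

Lemma at_revM x y : at_rev (x * y) = at_rev y * at_rev x.
Proof.
have [[u ->] [v ->]] := (at_class_surj x, at_class_surj y).
by rewrite at_mulgE !at_rev_class at_mulgE rev_cat.
Qed.

Lemma at_rev_gen s : at_rev (gen s) = gen s.
Proof. by rewrite at_rev_class. Qed.

Lemma at_rev1 : at_rev 1 = 1.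
Proof. by rewrite -at_class_nil at_rev_class. Qed.

Lemma at_rev_alt a b n : a != b -> ell a b = Some n -> at_rev (alt a b n) = alt a b n.
Proof.
move=> nab lab; rewrite at_rev_class rev_alternating; case: odd => //.
by rewrite -/(alt b a n) (alt_braid nab lab).
Qed.

End Reversal.

(** * The geometric representation *)
Section Geometry.
Local Open Scope ring_scope.
Implicit Types (a b s t : Sigma) (v w : V) (u : seq Sigma) (x y z : A).

(** The Gram matrix of the simple roots for Tits' canonical form. *)
Definition gram a b : R :=
  if a == b then 1 else if ell a b is Some m then - cos (pi / m%:R) else -1.

Lemma gramxx a : gram a a = 1. Proof. by rewrite /gram eqxx. Qed.

Lemma gram_sym a b : gram a b = gram b a.
Proof. by rewrite /gram eq_sym ell_sym. Qed.

Definition form v w : R := \sum_s \sum_t v s * w t * gram s t.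

Lemma form_sym v w : form v w = form w v.
Proof.
rewrite /form exchange_big; apply: eq_bigr => s _; apply: eq_bigr => t _.
by rewrite gram_sym; ring.
Qed.

Lemma formDl v v' w : form (v + v') w = form v w + form v' w.
Proof.
rewrite /form -big_split; apply: eq_bigr => s _; rewrite -big_split.
by apply: eq_bigr => t _; rewrite ffunE /=; ring.
Qed.

Lemma formZl (c : R) v w : form (c *: v) w = c * form v w.
Proof.
rewrite /form mulr_sumr; apply: eq_bigr => s _; rewrite mulr_sumr.
by apply: eq_bigr => t _; rewrite ffunE /GRing.scale /=; ring.
Qed.

Lemma formDr v w w' : form v (w + w') = form v w + form v w'.
Proof. by rewrite form_sym formDl !(form_sym v). Qed.

Lemma formZr (c : R) v w : form v (c *: w) = c * form v w.
Proof. by rewrite form_sym formZl (form_sym v). Qed.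

Lemma formNl v w : form (- v) w = - form v w.
Proof. by rewrite -scaleN1r formZl mulN1r. Qed.

Lemma formNr v w : form v (- w) = - form v w.
Proof. by rewrite -scaleN1r formZr mulN1r. Qed.

Lemma formBl v v' w : form (v - v') w = form v w - form v' w.
Proof. by rewrite formDl formNl. Qed.

Lemma formBr v w w' : form v (w - w') = form v w - form v w'.
Proof. by rewrite formDr formNr. Qed.

Definition formE := (formDl, formDr, formNl, formNr, formZl, formZr).

Definition simple s : V := [ffun t => (t == s)%:R].

Lemma simpleE s t : simple s t = (t == s)%:R. Proof. by rewrite ffunE. Qed.

Lemma form_simple v s : form v (simple s) = \sum_t v t * gram t s.
Proof.
rewrite /form; apply: eq_bigr => t _; rewrite (bigD1 s) //= big1 ?addr0.
  by rewrite simpleE eqxx mulr1.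
by move=> r rs; rewrite simpleE (negbTE rs) mulr0 mul0r.
Qed.

Lemma form_simple2 a b : form (simple a) (simple b) = gram a b.
Proof.
rewrite form_simple (bigD1 a) //= big1 ?addr0; first by rewrite simpleE eqxx mul1r.
by move=> r rs; rewrite simpleE (negbTE rs) mul0r.
Qed.

Lemma form_simplexx s : form (simple s) (simple s) = 1.
Proof. by rewrite form_simple2 gramxx. Qed.

Lemma form_coord v w : form v w = \sum_s w s * form v (simple s).
Proof.
rewrite [LHS]exchange_big; apply: eq_bigr => t _.
by rewrite form_simple mulr_sumr; apply: eq_bigr => r _; ring.
Qed.

Definition refl s v : V := v - (2 * form v (simple s)) *: simple s.

Lemma reflD s v w : refl s (v + w) = refl s v + refl s w.
Proof. by apply/ffunP => t; rewrite /refl !formE !ffunE /GRing.scale /=; ring. Qed.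

Lemma reflZ s (c : R) v : refl s (c *: v) = c *: refl s v.
Proof. by apply/ffunP => t; rewrite /refl !formE !ffunE /GRing.scale /=; ring. Qed.

Lemma reflK s v : refl s (refl s v) = v.
Proof.
apply/ffunP => t; rewrite /refl !formE form_simplexx !ffunE /GRing.scale /=; ring.
Qed.

Lemma refl_simple s : refl s (simple s) = - simple s.
Proof. by apply/ffunP => t; rewrite /refl form_simplexx !ffunE /GRing.scale /=; ring. Qed.

Lemma form_refl s v w : form (refl s v) (refl s w) = form v w.
Proof. rewrite /refl !formE form_simplexx (form_sym (simple s)); ring. Qed.

Lemma refl_neq s v t : t != s -> refl s v t = v t.
Proof.
by move=> ts; rewrite /refl !ffunE (negbTE ts) /GRing.scale /= mulr0 subr0.
Qed.

Lemma refl_fix s v : form v (simple s) = 0 -> refl s v = v.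
Proof. by move=> v0; rewrite /refl v0 mulr0 scale0r subr0. Qed.

Definition rho u v : V := foldr refl v u.

Lemma rho_cat u u' v : rho (u ++ u') v = rho u (rho u' v).
Proof. by rewrite /rho foldr_cat. Qed.

Lemma rhoD u v w : rho u (v + w) = rho u v + rho u w.
Proof. by elim: u => //= s u ->; rewrite reflD. Qed.

Lemma rhoZ u (c : R) v : rho u (c *: v) = c *: rho u v.
Proof. by elim: u => //= s u ->; rewrite reflZ. Qed.

Lemma rho_fix u v : (forall s, s \in u -> form v (simple s) = 0) -> rho u v = v.
Proof.
elim: u => //= s u IH H; rewrite IH.
  by rewrite refl_fix // H // mem_head.
by move=> t tu; apply: H; rewrite inE tu orbT.
Qed.

(** The roots met along an alternating word. Only the first letter is peeled
    off, so that the induction exchanges the roles of [a] and [b]. *)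
Lemma rho_alternating a b k : a != b ->
  rho (alternating a b k) (simple (nxt a b k)) =
  cheb (- gram a b) k.+1 *: simple a + cheb (- gram a b) k *: simple b.
Proof.
elim: k a b => [|k IH] a b nab; first by rewrite cheb0 cheb1 scale1r scale0r addr0.
rewrite alternatingS /=.
have -> : nxt a b k.+1 = nxt b a k by rewrite /nxt /=; case: odd.
rewrite IH 1?eq_sym // reflD !reflZ refl_simple (gram_sym b a) chebSS.
apply/ffunP => r; rewrite /refl form_simple2 (gram_sym b a) !ffunE /GRing.scale /=; ring.
Qed.

Lemma rho_alternating_simple a b m : a != b -> ell a b = Some m ->
  rho (alternating a b m) (simple (nxt a b m)) = - simple a /\
  rho (alternating a b m) (simple (nxt b a m)) = - simple b.
Proof.
move=> nab lab; have m2 := ell_ge2 lab.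
have cE : - gram a b = cos (pi / m%:R) by rewrite /gram (negbTE nab) lab opprK.
have Um := cheb_angle_m R m2; have Um1 := cheb_angle_m1 R m2.
case: m lab m2 cE Um Um1 => // m lab m2 cE Um Um1; split.
  rewrite rho_alternating // cE chebSS Um Um1 mulr0 sub0r scaleN1r.
  by rewrite scale0r addr0.
have -> : nxt b a m.+1 = nxt a b m by rewrite /nxt /=; case: odd.
rewrite alternating_rcons -cats1 rho_cat /= -/(nxt a b m) refl_simple.
rewrite -scaleN1r rhoZ rho_alternating // cE Um Um1 scale0r add0r scale1r.
by rewrite scaleN1r.
Qed.

(** Both words agree on the two simple roots by the explicit formula and fix
    the orthogonal complement of their plane. The plane is nondegenerate since
    the order [m] is finite, so these vectors span everything. *)
Lemma rho_alternating_braid a b m v : a != b -> ell a b = Some m ->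
  rho (alternating a b m) v = rho (alternating b a m) v.
Proof.
move=> nab lab.
have nba : b != a by rewrite eq_sym.
have lba : ell b a = Some m by rewrite ell_sym.
have [Aa Ab] := rho_alternating_simple nab lab.
have [Bb Ba] := rho_alternating_simple nba lba.
have Ea : rho (alternating a b m) (simple a) = rho (alternating b a m) (simple a).
  by move: Aa Ab Ba Bb; rewrite /nxt; case: odd => ? ? ? ?; congruence.
have Eb : rho (alternating a b m) (simple b) = rho (alternating b a m) (simple b).
  by move: Aa Ab Ba Bb; rewrite /nxt; case: odd => ? ? ? ?; congruence.
set c := - gram a b; set p := form v (simple a); set q := form v (simple b).
have D0 : 1 - c ^+ 2 != 0.
  rewrite /c /gram (negbTE nab) lab opprK -sin2cos2.
  by rewrite expf_neq0 // lt0r_neq0 // sin_angle_gt0 // (ell_ge2 lab).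
  (* the component of v orthogonal to the plane of the two simple roots *)
pose w := v - ((p + c * q) / (1 - c ^+ 2)) *: simple a
            - ((q + c * p) / (1 - c ^+ 2)) *: simple b.
have vE : v = w + ((p + c * q) / (1 - c ^+ 2)) *: simple a
            + ((q + c * p) / (1 - c ^+ 2)) *: simple b.
  by rewrite /w [RHS]addrAC !subrK.
have wa : form w (simple a) = 0.
  rewrite /w !formE form_simplexx form_simple2 (gram_sym b a) -/p -[gram a b]opprK -/c.
  by field.
have wb : form w (simple b) = 0.
  rewrite /w !formE form_simplexx form_simple2 -/q -[gram a b]opprK -/c.
  by field.
clearbody w; have wf e f n : (e == a) || (e == b) -> (f == a) || (f == b) ->
    rho (alternating e f n) w = w.
  move=> he hf; apply: rho_fix => s /mapP [i _ ->].
  by case: (odd i); [case/orP: hf | case/orP: he] => /eqP ->.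
by rewrite vE !rhoD !rhoZ Ea Eb !wf ?eqxx ?orbT.
Qed.

Lemma rho_braid_eq u u' v : braid_eq ell u u' -> rho u v = rho u' v.
Proof.
move=> E; elim: E v => [a b n u1 u2 nab lab|//|u1 u2 _ IH|u1 u2 u3 _ IH1 _ IH2] v.
- by rewrite !rho_cat (rho_alternating_braid _ nab lab).
- by rewrite IH.
- by rewrite IH1.
Qed.

Definition act x v : V := rho (word_repr x) v.

Lemma act_class u v : act (cls u) v = rho u v.
Proof. by apply: (at_lift_class (f := fun u => rho u v)) => ? ?; apply: rho_braid_eq. Qed.

Lemma actM x y v : act (x * y)%g v = act x (act y v).
Proof.
have [[u ->] [u' ->]] := (at_class_surj x, at_class_surj y).
by rewrite at_mulgE !act_class rho_cat.
Qed.

Lemma act1 v : act 1%g v = v. Proof. by rewrite -at_class_nil act_class. Qed.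

Lemma act_gen s v : act (gen s) v = refl s v. Proof. by rewrite act_class. Qed.

Lemma actD x v w : act x (v + w) = act x v + act x w. Proof. exact: rhoD. Qed.
Lemma actZ x (c : R) v : act x (c *: v) = c *: act x v. Proof. exact: rhoZ. Qed.
Lemma actN x v : act x (- v) = - act x v.
Proof. by rewrite -scaleN1r actZ scaleN1r. Qed.
Lemma actB x v w : act x (v - w) = act x v - act x w.
Proof. by rewrite actD actN. Qed.

Lemma form_act x v w : form (act x v) (act x w) = form v w.
Proof. by elim/at_indl: x v w => [|s x IH] v w; rewrite ?act1 // !actM !act_gen form_refl. Qed.

Lemma act_revK x v : act (at_rev x) (act x v) = v.
Proof.
elim/at_indl: x v => [|s x IH] v; first by rewrite at_rev1 // !act1.
by rewrite at_revM // actM at_rev_gen // (actM (gen s)) !act_gen reflK IH.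
Qed.

Lemma act_revVK x v : act x (act (at_rev x) v) = v.
Proof. by rewrite -{1}(at_revK x) act_revK. Qed.

Lemma act_inj x : injective (act x).
Proof. by apply: can_inj (act_revK x). Qed.

Lemma act_alt a b k : a != b -> act (alt a b k) (simple (nxt a b k)) =
  cheb (- gram a b) k.+1 *: simple a + cheb (- gram a b) k *: simple b.
Proof. by move=> nab; rewrite act_class rho_alternating. Qed.

Definition le_order a b k := if ell a b is Some m then (k <= m)%N else true.

Lemma cheb_gram_ge0 a b k : a != b -> le_order a b k -> 0 <= cheb (- gram a b) k.
Proof.
rewrite /le_order /gram => /negbTE ->; case E: (ell a b) => [m|] km; rewrite opprK.
  by apply: cheb_angle_ge0 => //; apply: ell_ge2 E.
by rewrite cheb_one.
Qed.

Definition pos v : Prop := (forall s, 0 <= v s) /\ v <> 0.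

Lemma pos_simple s : pos (simple s).
Proof.
split=> [t|/ffunP /(_ s)]; first by rewrite simpleE ler0n.
by rewrite simpleE ffunE eqxx => /eqP; rewrite oner_eq0.
Qed.

Lemma pos_neg v : pos v -> ~ pos (- v).
Proof.
move=> [v0 vn] [w0 _]; apply: vn; apply/ffunP => s; rewrite ffunE.
by apply/eqP; rewrite eq_le v0 andbT -oppr_ge0; have := w0 s; rewrite ffunE.
Qed.

Lemma form_self_pos v : form v v = 1 -> (forall s, 0 <= v s) -> pos v.
Proof.
move=> v1 v0; split=> // vE; move: v1; rewrite vE -(scale0r 0) formZl mul0r => /eqP.
by rewrite eq_sym oner_eq0.
Qed.

End Geometry.

(** * Square-free elements *)
Section SquareFree.
Local Open Scope ring_scope.
Implicit Types (a b s t : Sigma) (u : seq Sigma) (x y z : A).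

(** Square-free elements are the reduced lifts of the elements of the Coxeter
    group. This definition speaks of all words of [x] at once and is visibly
    inherited by prefixes and suffixes. *)
Definition sqf x : Prop := forall y z s, x <> (y * gen s * gen s * z)%g.
Definition rdesc x s : Prop := exists y, x = (y * gen s)%g.
Definition ldesc x s : Prop := lediv_l (gen s) x.

Lemma sqf1 : sqf 1%g.
Proof. by move=> y z s /(congr1 at_len); rewrite !at_lenM at_len_gen at_len1; lia. Qed.

Lemma sqf_mull x y : sqf (x * y)%g -> sqf x.
Proof. by move=> xy p q s E; apply: (xy p (q * y)%g s); rewrite E -!mulgA. Qed.

Lemma sqf_mulr x y : sqf (x * y)%g -> sqf y.
Proof. by move=> xy p q s E; apply: (xy (x * p)%g q s); rewrite E !mulgA. Qed.

Lemma sqf_rdesc x s : sqf (x * gen s)%g -> ~ rdesc x s.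
Proof. by move=> xs [y E]; apply: (xs y 1%g s); rewrite E mulg1. Qed.

Lemma sqf_ldesc x s : sqf (gen s * x)%g -> ~ ldesc x s.
Proof. by move=> xs [y E]; apply: (xs 1%g y s); rewrite E mul1g !mulgA. Qed.

Lemma sqf_lediv x y : lediv_l x y -> sqf y -> sqf x.
Proof. by move=> [z ->] /sqf_mull. Qed.

Lemma sqf_rev x : sqf x -> sqf (at_rev x).
Proof.
move=> sx y z s /(congr1 at_rev); rewrite at_revK // !at_revM // !at_rev_gen //.
by move=> E; apply: (sx (at_rev z) (at_rev y) s); rewrite E !mulgA.
Qed.

Lemma ldesc_rev x s : ldesc (at_rev x) s <-> rdesc x s.
Proof.
split=> [[y E]|[y ->]]; last first.
  by exists (at_rev y); rewrite at_revM // at_rev_gen.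
by exists (at_rev y); rewrite -(at_revK x) E at_revM // at_rev_gen.
Qed.

Lemma rdesc_rev x s : rdesc (at_rev x) s <-> ldesc x s.
Proof. by rewrite -ldesc_rev at_revK. Qed.

(** Beyond the length of the braid relation, rewriting an alternating word by
    that relation creates a square at its beginning. *)
Lemma sqf_alt a b k : a != b -> sqf (alt a b k) -> le_order a b k.
Proof.
move=> nab sk; rewrite /le_order; case E: (ell a b) => [m|] //; rewrite leqNgt.
apply/negP => mk; have m2 := ell_ge2 E.
have [j kE] : exists j, k = (m.+1 + j)%N by exists (k - m.+1)%N; lia.
move: sk; rewrite kE; have [e [f [-> _]]] := alt_split a b m.+1 j.
move=> /sqf_mull; rewrite altS -(alt_braid nab E).
case: m m2 {E mk kE} => // m _; rewrite altS => /(_ 1%g (alt b a m) a); apply.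
by rewrite mul1g mulgA.
Qed.

(** Splits off the longest suffix of [x] that alternates between [s] and [t]. A
    further letter [s] or [t] at the end of the other factor would either
    lengthen this suffix or create a square. *)
Lemma rank2_decomposition x s t : sqf x -> rdesc x t -> s != t ->
  exists v a b k, [/\ x = (v * alt a b k.+1)%g, nxt a b k.+1 = s,
    a = s /\ b = t \/ a = t /\ b = s, ~ rdesc v a /\ ~ rdesc v b
    & le_order a b k.+1].
Proof.
move=> sx [x' xE] nst.
pose Q k := exists v a b, [/\ x = (v * alt a b k)%g, nxt a b k = s
    & a = s /\ b = t \/ a = t /\ b = s].
have Q1 : Q 1%N by exists x', t, s; rewrite alt1; split=> //; right.
have exQ : exists k, `[< Q k >] by exists 1%N; apply/asboolP.
have ubQ k : `[< Q k >] -> (k <= at_len x)%N.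
  by move=> /asboolP [v [a [b [-> _ _]]]]; rewrite at_lenM at_len_alt leq_addl.
have [k /asboolP Qk kmax] := ex_maxnP exQ ubQ.
have k0 : (0 < k)%N by apply: kmax; apply/asboolP.
case: k Qk kmax k0 => // k [v [a [b [E nE ab]]]] kmax _.
have nab : a != b by case: ab => [[-> ->]|[-> ->]] //; rewrite eq_sym.
exists v, a, b, k; split => //; last by apply: sqf_alt => //; apply: (@sqf_mulr v); rewrite -E.
split=> [] [v' vE].
  by apply: (sx v' (alt b a k) a); rewrite E vE altS !mulgA.
suff : Q k.+2 by move=> /asboolP /kmax; rewrite ltnn.
exists v', b, a; split.
- by rewrite E vE (altS b a) !mulgA.
- by rewrite -nE /nxt /=; case: odd.
- by case: ab => [[-> ->]|[-> ->]]; [right|left].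
Qed.

Lemma form_root x s : form (act x (simple s)) (act x (simple s)) = 1.
Proof. by rewrite form_act // form_simplexx. Qed.

Lemma pos_alt_comb (v : A) a b k : a != b ->
  pos (act v (simple a)) -> pos (act v (simple b)) -> le_order a b k.+1 ->
  pos (act (v * alt a b k)%g (simple (nxt a b k))).
Proof.
move=> nab [pa _] [pb _] lek; apply: form_self_pos; first exact: form_root.
move=> r; rewrite actM // act_alt // actD !actZ !ffunE.
have lek' : le_order a b k by move: lek; rewrite /le_order; case: (ell a b) => // m; lia.
by apply: addr_ge0; apply: mulr_ge0 => //; apply: cheb_gram_ge0.
Qed.

Lemma rdesc_alt a b k : a != b -> ell a b = Some k.+1 ->
  rdesc (alt a b k.+1) (nxt a b k.+1).
Proof.
move=> nab E; exists (alt b a k); rewrite (alt_braid nab E) altSr.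
by congr (_ * gen _)%g; rewrite /nxt /=; case: odd.
Qed.

(** The last letters of a square-free element are read off the signs of roots.
    After the rank-two decomposition [x = v * alt a b k.+1] the root is a
    nonnegative combination of the images under [v] of two simple roots, which
    are positive by induction; the coefficients are nonnegative because the
    alternating factor, not ending with [s], is shorter than the braid
    relation. *)
Theorem ndesc_pos x s : sqf x -> ~ rdesc x s -> pos (act x (simple s)).
Proof.
have [n] := ubnP (at_len x); elim: n x s => // n IH x s xn sx ns.
have [->|[x' [t xE]]] := at_caser x; first by rewrite act1 //; apply: pos_simple.
have st : s != t by apply/eqP => st; apply: ns; exists x'; rewrite st.
have tx : rdesc x t by exists x'.
have [v [a [b [k [E nE ab [na nb] le]]]]] := rank2_decomposition sx tx st.
have nab : a != b by case: ab => [[-> ->]|[-> ->]] //; rewrite eq_sym.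
have vn : (at_len v < n)%N by move: xn; rewrite E at_lenM at_len_alt; lia.
have sv : sqf v by apply: (@sqf_mull _ (alt a b k.+1)); rewrite -E.
rewrite E -nE; apply: pos_alt_comb => //; try exact: IH.
move: le; rewrite /le_order; case El: (ell a b) => [m|] // km.
rewrite ltn_neqAle km andbT; apply/eqP => kE; rewrite -kE in El.
have [y yE] := rdesc_alt nab El; apply: ns; exists (v * y)%g.
by rewrite E yE nE mulgA.
Qed.

Lemma desc_neg x s : sqf x -> rdesc x s -> pos (- act x (simple s)).
Proof.
move=> sx [y E]; rewrite E actM // act_gen // refl_simple actN // opprK.
by apply: ndesc_pos; [apply: (@sqf_mull _ (gen s)); rewrite -E|apply: sqf_rdesc; rewrite -E].
Qed.

Lemma neg_desc x s : sqf x -> pos (- act x (simple s)) -> rdesc x s.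
Proof.
move=> sx neg; apply: contrapT => /(ndesc_pos sx) /pos_neg; exact.
Qed.

(** The last letter of one element is, by the sign of a root, a last letter of
    the other, and both can be shortened. *)
Lemma sqf_act_inj x y : sqf x -> sqf y -> act x =1 act y -> x = y.
Proof.
elim/at_indr: x y => [|x s IH] y sx sy E.
  have [->|[y' [s yE]]] := at_caser y => //.
  have /(desc_neg sy) : rdesc y s by exists y'.
  by rewrite -E act1 // => /pos_neg; rewrite opprK => /(_ (pos_simple _)).
have [y' yE] : rdesc y s by apply: (neg_desc sy); rewrite -E; apply: desc_neg => //; exists x.
rewrite yE; congr (_ * _)%g; apply: IH; first exact: sqf_mull sx.
  by apply: (@sqf_mull _ (gen s)); rewrite -yE.
move=> v; have := E (refl s v); rewrite yE !actM // !act_gen //.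
by rewrite !reflK.
Qed.

Lemma sqf_reduce x : exists y, [/\ sqf y, act y =1 act x & (at_len y <= at_len x)%N].
Proof.
have [n] := ubnP (at_len x); elim: n x => // n IH x xn.
have [sx|] := pselect (sqf x); first by exists x.
move=> /existsNP [p /existsNP [q /existsNP [s /contrapT E]]].
have [|y [sy yE yl]] := IH (p * q)%g.
  by move: xn; rewrite E !at_lenM at_len_gen; lia.
exists y; split=> // [v|]; last by move: yl; rewrite E !at_lenM; lia.
by rewrite yE E !actM // !act_gen // reflK.
Qed.

(** A shortest element acting like [x * gen s] ends with [s], because it makes
    the simple root of [s] negative; without this letter it acts like [x] and
    is therefore [x]. *)
Lemma sqf_rcons x s : sqf x -> ~ rdesc x s -> sqf (x * gen s)%g.
Proof.
move=> sx ns; have [y [sy yE _]] := sqf_reduce (x * gen s)%g.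
suff : rdesc y s.
  move=> [y' y'E]; suff <- : y' = x by rewrite -y'E.
  apply: sqf_act_inj => //; first by apply: (@sqf_mull _ (gen s)); rewrite -y'E.
  move=> v; have := yE (refl s v); rewrite y'E !actM // !act_gen //.
  by rewrite !reflK.
apply: neg_desc => //; rewrite yE actM // act_gen // refl_simple actN // opprK.
exact: ndesc_pos.
Qed.

Lemma sqf_cons x s : sqf x -> ~ ldesc x s -> sqf (gen s * x)%g.
Proof.
move=> sx ns; rewrite -(at_revK (_ * _)%g); apply: sqf_rev.
rewrite at_revM // at_rev_gen //; apply: sqf_rcons; first exact: sqf_rev.
by rewrite rdesc_rev.
Qed.

Lemma sqf_mulIl v x y : sqf (v * x)%g -> (v * x = v * y)%g -> x = y.
Proof.
move=> svx E; apply: sqf_act_inj; first exact: sqf_mulr svx.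
  by move: svx; rewrite E; apply: sqf_mulr.
by move=> w; apply: (@act_inj v); rewrite -!actM // E.
Qed.

Lemma pos_refl_neg s (v : V) : form v v = 1 -> pos v -> pos (- refl s v) -> v = simple s.
Proof.
move=> v1 [v0 _] [n0 _].
have vr r : r != s -> v r = 0.
  move=> rs; apply/eqP; rewrite eq_le v0 andbT -oppr_ge0.
  by have := n0 r; rewrite ffunE refl_neq.
have vE : v = v s *: simple s.
  apply/ffunP => r; rewrite ffunE simpleE; case: eqP => [->|/eqP rs].
    by rewrite /GRing.scale /= mulr1.
  by rewrite vr // scaler0.
move: v1; rewrite vE formZl formZr // form_simplexx mulr1 => /eqP.
rewrite -expr2 sqrf_eq1 => /orP [/eqP ->|/eqP vs]; first by rewrite scale1r.
by have := v0 s; rewrite vs ler0N1.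
Qed.

(** The positive root [act w (simple t)] becomes negative under the reflection
    [s], so it is the simple root of [s] and the two products have the same
    action. *)
Lemma sqf_exchange w s t : sqf (gen s * w)%g -> sqf (w * gen t)%g ->
  ~ sqf (gen s * w * gen t)%g -> (gen s * w = w * gen t)%g.
Proof.
move=> sw wt nswt; apply: sqf_act_inj => //.
have bE : act w (simple t) = simple s.
  apply: pos_refl_neg; first exact: form_root.
    by apply: ndesc_pos; [exact: sqf_mull wt|exact: sqf_rdesc].
  rewrite -act_gen // -actM //; apply: desc_neg => //.
  by apply: contrapT => /(sqf_rcons sw).
move=> v; rewrite !actM // !act_gen // /refl actB // actZ // bE; congr (_ - (2 * _) *: _).
by rewrite -bE form_act.
Qed.

(** In the weak order: the wall of [s] separates [j] but not [x] from 1, so it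
    is crossed after [x], and reflecting the rest of the path there gives a
    geodesic from [x] to the mirror image of [j]. *)
Lemma lediv_lift j x s : sqf j -> lediv_l x j -> ldesc j s -> ~ ldesc x s ->
  exists j', j = (gen s * j')%g /\ lediv_l x j'.
Proof.
move=> + [z jE]; rewrite jE {j jE}; elim/at_indr: z => [|z t IH] sj js ns.
  by rewrite mulg1 in js.
rewrite mulgA in sj js *.
have [xz|nxz] := pselect (ldesc (x * z)%g s).
  have [j' [-> xj]] := IH (sqf_mull sj) xz ns.
  exists (j' * gen t)%g; split; first by rewrite mulgA.
  exact: lediv_trans xj (lediv_mulr _ _).
exists (x * z)%g; split; last exact: lediv_mulr.
apply/esym/sqf_exchange => //; first exact: sqf_cons (sqf_mull sj) nxz.
case: js => y E H; apply: (H 1%g y s); rewrite mul1g -!mulgA.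
by congr (_ * _)%g; rewrite -E mulgA.
Qed.

Lemma sqf_mul_alt g a b k : a != b -> sqf g -> ~ rdesc g a -> ~ rdesc g b ->
  le_order a b k -> sqf (g * alt a b k)%g.
Proof.
move=> nab sg na nb; elim: k => [|k IH] lek; first by rewrite alt0 mulg1.
have lek' : le_order a b k by move: lek; rewrite /le_order; case: (ell a b) => // m; lia.
rewrite altSr mulgA; apply: sqf_rcons; first exact: IH.
move=> /(desc_neg (IH lek')); apply: pos_neg.
by apply: pos_alt_comb => //; apply: ndesc_pos.
Qed.

(** Otherwise the computation of [ndesc_pos] would make a root positive that is
    negative because [j] ends with [s]. *)
Lemma two_rdesc j s t : sqf j -> rdesc j s -> rdesc j t -> s != t ->
  exists m c, [/\ ell s t = Some m, j = (c * alt s t m)%g, ~ rdesc c s & ~ rdesc c t].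
Proof.
move=> sj js jt st.
have [v [a [b [k [E nE ab [na nb] le]]]]] := rank2_decomposition sj jt st.
have nab : a != b by case: ab => [[-> ->]|[-> ->]] //; rewrite eq_sym.
have sv : sqf v by apply: (@sqf_mull _ (alt a b k.+1)); rewrite -E.
have Eab : ell a b = Some k.+1.
  apply: contrapT => nEab; have lek : le_order a b k.+2.
    move: le nEab; rewrite /le_order; case: (ell a b) => // m km nm.
    rewrite ltn_neqAle km andbT; apply/eqP => kE; by rewrite kE in nm.
  have := desc_neg sj js; rewrite E -nE; apply: pos_neg.
  by apply: pos_alt_comb => //; apply: ndesc_pos.
exists k.+1, v; case: ab => [[<- <-]|[<- <-]]; split=> //.
  by rewrite ell_sym.
by rewrite E (alt_braid nab Eab).
Qed.

Lemma two_ldesc j s t : sqf j -> ldesc j s -> ldesc j t -> s != t ->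
  exists m, ell s t = Some m /\ lediv_l (alt s t m) j.
Proof.
move=> sj; rewrite -!rdesc_rev => js jt st.
have [m [c [E jE _ _]]] := two_rdesc (sqf_rev sj) js jt st.
exists m; split => //; exists (at_rev c).
by rewrite -(at_revK j) jE at_revM // at_rev_alt.
Qed.

Lemma root_sign x s : pos (act x (simple s)) \/ pos (- act x (simple s)).
Proof.
have [y [sy yE _]] := sqf_reduce x; rewrite -yE.
have [ys|ns] := pselect (rdesc y s); first by right; apply: desc_neg.
by left; apply: ndesc_pos.
Qed.

End SquareFree.

(** * Bounded joins, greatest square-free prefixes and cancellation *)
Section BoundedJoins.
Local Open Scope group_scope.
Implicit Types (s t : Sigma) (v x y z k m : A) (P : A -> Prop).

(** Least common multiples are needed first among square-free elements and then
    in the whole monoid. In both cases they follow from cancellation and from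
    joins of two letters, so the argument is made once, relative to a
    predicate [P]. *)
Definition lub_in P x y k : Prop := [/\ lediv_l x k, lediv_l y k
  & forall m, P m -> lediv_l x m -> lediv_l y m -> lediv_l k m].

Context (P : A -> Prop) (D : Sigma -> Sigma -> A).
Context (Pr : forall x y, P (x * y) -> P y).
Context (Pcan : forall v x y, P (v * x) -> v * x = v * y -> x = y).
Context (Datom : forall m s t, P m -> s != t -> ldesc m s -> ldesc m t ->
   [/\ ldesc (D s t) s, ldesc (D s t) t & lediv_l (D s t) m]).

Lemma lediv_cancel_in v x m : P (v * m) -> lediv_l (v * x) (v * m) -> lediv_l x m.
Proof. by move=> Pm [p]; rewrite -mulgA => /(Pcan Pm) ->; exists p. Qed.

Lemma lub_mul2l v x y k : lub_in P x y k -> lub_in P (v * x) (v * y) (v * k).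
Proof.
move=> [xk yk kmin]; split; try exact: lediv_mul2l.
move=> m Pm [p mE]; move: Pm; rewrite mE -mulgA => Pm /(lediv_cancel_in Pm) ym.
apply/lediv_mul2l/kmin => //; [exact: Pr Pm|exact: lediv_mulr].
Qed.

(** With [x = s x'] and [y = t y'], the join of [s] and [t] divides [m]. It is
    joined with [x] (after cancelling [s]), with [y] (after cancelling [t]), and
    the two results are joined after cancelling it: three joins below proper
    quotients of [m]. *)
Lemma bounded_lub_in m x y : P m -> lediv_l x m -> lediv_l y m ->
  exists k, lub_in P x y k.
Proof.
have [n] := ubnP (at_len m); elim: n m x y => // n IH m x y mn Pm xm ym.
have [xE|[s [x' xE]]] := at_casel x.
  by exists y; rewrite xE; split; [exact: lediv1|exact: lediv_refl|].
have [yE|[t [y' yE]]] := at_casel y.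
  by exists x; rewrite yE; split; [exact: lediv_refl|exact: lediv1|].
subst x y.
have IHs v x y : v <> 1 -> lediv_l (v * x) m -> lediv_l (v * y) m ->
    exists k, lub_in P (v * x) (v * y) (v * k).
  move=> v1 [p mE]; rewrite mE -mulgA => vy.
  have Pm' : P (v * (x * p)) by rewrite mulgA -mE.
  have := lediv_cancel_in Pm' vy => yxp.
  have [|k /(lub_mul2l v) lk] := IH (x * p) x y _ (Pr Pm') (lediv_mulr _ _) yxp.
    have : at_len v <> 0%N by move/at_len_eq0.
    by move: mn; rewrite mE !at_lenM; lia.
  by exists k.
have gen1 r : gen r <> 1 by move=> /(congr1 at_len); rewrite at_len_gen at_len1.
have [st|/eqP st] := eqVneq s t.
  by subst t; have [k] := IHs _ _ _ (gen1 s) xm ym; exists (gen s * k).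
move/eqP in st.
have sm : ldesc m s by apply: lediv_trans xm; apply: lediv_mulr.
have tm : ldesc m t by apply: lediv_trans ym; apply: lediv_mulr.
have [[a aE] [b bE] Dm] := Datom Pm st sm tm.
have [k1 [xk1 Dk1 k1min]] : exists k, lub_in P (gen s * x') (D s t) k.
  have [|k] := IHs (gen s) x' a (gen1 s) xm; first by rewrite -aE.
  by rewrite -aE; exists (gen s * k).
have [k2 [yk2 Dk2 k2min]] : exists k, lub_in P (gen t * y') (D s t) k.
  have [|k] := IHs (gen t) y' b (gen1 t) ym; first by rewrite -bE.
  by rewrite -bE; exists (gen t * k).
have k1m := k1min _ Pm xm Dm; have k2m := k2min _ Pm ym Dm.
case: Dk1 => p pE; case: Dk2 => q qE.
have D1 : D s t <> 1 by rewrite aE => /at_mul_eq1 [/gen1].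
have [||k [pk qk kmin]] := IHs (D s t) p q D1; rewrite -?pE -?qE //.
exists (D s t * k); split.
- by apply: lediv_trans pk; rewrite -pE.
- by apply: lediv_trans qk; rewrite -qE.
move=> m' Pm' xm' ym'.
have sm' : ldesc m' s by apply: lediv_trans xm'; apply: lediv_mulr.
have tm' : ldesc m' t by apply: lediv_trans ym'; apply: lediv_mulr.
have [_ _ Dm'] := Datom Pm' st sm' tm'.
by apply: kmin => //; rewrite -?pE -?qE; [apply: k1min|apply: k2min].
Qed.

End BoundedJoins.

Section Head.
Local Open Scope group_scope.
Implicit Types (a b s t : Sigma) (u : seq Sigma) (v w x y z : A) (p : A * A).

Definition atom_join s t : A := if ell s t is Some m then alt s t m else 1.

Lemma atom_join_desc s t m : s != t -> ell s t = Some m ->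
  [/\ ldesc (alt s t m) s & ldesc (alt s t m) t].
Proof.
move=> st E; have := ell_ge2 E; case: m E => // m E _; split.
  by rewrite altS; apply: lediv_mulr.
by rewrite (alt_braid st E) altS; apply: lediv_mulr.
Qed.

Lemma sqf_atom_join m s t : sqf m -> s != t -> ldesc m s -> ldesc m t ->
  [/\ ldesc (atom_join s t) s, ldesc (atom_join s t) t & lediv_l (atom_join s t) m].
Proof.
move=> sm st ms mt; have [n [E le]] := two_ldesc sm ms mt st.
by rewrite /atom_join E; have [] := atom_join_desc st E.
Qed.

Lemma sqf_lub m x y : sqf m -> lediv_l x m -> lediv_l y m ->
  exists k, lub_in sqf x y k.
Proof.
apply: bounded_lub_in; [exact: sqf_mulr|exact: sqf_mulIl|exact: sqf_atom_join].
Qed.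

Lemma sqf_lediv_cancel v x m : sqf (v * m) -> lediv_l (v * x) (v * m) -> lediv_l x m.
Proof. by apply: (@lediv_cancel_in sqf); apply: sqf_mulIl. Qed.

(** If a letter [r] of the multiplier became a prefix of what it multiplies in
    [v k], lifting [v x] and [v y] past [r] would give a common multiple of [x]
    and [y] shorter than [k]. *)
Lemma sqf_mul_lub v x y j k : sqf j -> lediv_l x j -> lediv_l y j ->
  lub_in sqf x y k -> sqf (v * x) -> sqf (v * y) -> sqf (v * k).
Proof.
move=> sj xj yj [xk yk kmin]; have kj := kmin _ sj xj yj; have sk := sqf_lediv kj sj.
elim/at_indl: v => [|r v IH]; first by rewrite !mul1g.
rewrite -!mulgA => sx sy; have svk := IH (sqf_mulr sx) (sqf_mulr sy).
apply: sqf_cons => // rvk.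
have [k' [E xk']] := lediv_lift svk (lediv_mul2l v xk) rvk (sqf_ldesc sx).
have [k1 [E1 yk']] := lediv_lift svk (lediv_mul2l v yk) rvk (sqf_ldesc sy).
have kE : k1 = k' by apply: (@sqf_mulIl (gen r)); rewrite -E1.
subst k1; have sk' : sqf k' by apply: (@sqf_mulr (gen r)); rewrite -E.
case: (lediv_trans (lediv_mulr v x) xk') => k2 k2E; subst k'.
have := kmin k2 (sqf_mulr sk') (sqf_lediv_cancel sk' xk') (sqf_lediv_cancel sk' yk').
by move=> /lediv_len; have := congr1 at_len E; rewrite !at_lenM at_len_gen; lia.
Qed.

Definition is_maxpref v w w1 : Prop := [/\ lediv_l w1 w, sqf (v * w1)
  & forall w', lediv_l w' w -> sqf (v * w') -> lediv_l w' w1].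

(** A longest candidate is greatest, because candidates are stable under
    joins. *)
Lemma maxpref_exists v w : sqf v -> sqf w -> exists w1, is_maxpref v w w1.
Proof.
move=> sv sw.
pose Q k := exists w1, [/\ lediv_l w1 w, sqf (v * w1) & at_len w1 = k].
have exQ : exists k, `[< Q k >].
  by exists 0%N; apply/asboolP; exists 1; rewrite mulg1 at_len1; split=> //; exact: lediv1.
have ubQ k : `[< Q k >] -> (k <= at_len w)%N.
  by move=> /asboolP [w1 [/lediv_len + _ <-]].
have [k /asboolP [w1 [w1w sw1 <-]] kmax] := ex_maxnP exQ ubQ.
exists w1; split=> // w' w'w sw'.
have [j jl] := sqf_lub sw w1w w'w.
have sj := sqf_mul_lub sw w1w w'w jl sw1 sw'.
case: jl => w1j w'j /(_ w sw w1w w'w) jw.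
suff -> : w1 = j by [].
by apply: lediv_len_eq w1j _; apply: kmax; apply/asboolP; exists j.
Qed.

Lemma maxpref_uniq v w w1 w1' : is_maxpref v w w1 -> is_maxpref v w w1' -> w1 = w1'.
Proof.
by move=> [l1 s1 m1] [l2 s2 m2]; apply: lediv_anti; [apply: m2|apply: m1].
Qed.

Definition maxpref v w : A := xget 1 [set w1 | is_maxpref v w w1]%classic.
Definition residue x y : A := xget 1 [set z | y = x * z]%classic.

(** Multiplying on the left by a square-free [v] moves to the remainder the part
    of the square-free component that cannot be absorbed. On generators this
    defines the action of the monoid on pairs. *)
Definition headstep v p : A * A :=
  (v * maxpref v p.1, residue (maxpref v p.1) p.1 * p.2).

Arguments headstep : simpl never.

Lemma headstepE v w1 w2 y : sqf (w1 * w2) -> is_maxpref v (w1 * w2) w1 ->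
  headstep v (w1 * w2, y) = (v * w1, w2 * y).
Proof.
move=> sw m1; rewrite /headstep /maxpref /=.
have -> : xget 1 [set w0 | is_maxpref v (w1 * w2) w0]%classic = w1.
  by case: xgetP => [w0 _ /= m0|/(_ w1)] //; apply: maxpref_uniq m0 m1.
congr (_, _ * _); rewrite /residue.
case: xgetP => [z _ /= E|/(_ w2) /(_ erefl)//].
by apply/esym/(sqf_mulIl sw).
Qed.

Lemma headstep_ex v w y : sqf v -> sqf w -> exists w1 w2,
  [/\ w = w1 * w2, is_maxpref v w w1 & headstep v (w, y) = (v * w1, w2 * y)].
Proof.
move=> sv sw; have [w1 m1] := maxpref_exists sv sw.
case: (m1) => [[w2 E] _ _]; exists w1, w2; split=> //.
by subst w; apply: headstepE.
Qed.

(** The steps compose along square-free products; hence the two sides of a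
    braid relation, which are square-free words for one element, act alike. *)
Lemma headstep_cons s v p : sqf (gen s * v) -> sqf p.1 ->
  headstep (gen s) (headstep v p) = headstep (gen s * v) p.
Proof.
case: p => w y sv /= sw.
have [w1 [w2 [wE m1 ->]]] := headstep_ex y (sqf_mulr sv) sw.
case: m1 => w1w svw1 max1.
have [y1 [y2 [E [y1l sy1 max2] ->]]] := headstep_ex (w2 * y) (sqf_mull sv) svw1.
have [u uE] := max2 v (lediv_mulr _ _) sv; subst y1.
have w1E : w1 = u * y2 by apply: (@sqf_mulIl v) => //; rewrite E mulgA.
have wE' : w = u * (y2 * w2) by rewrite wE w1E mulgA.
rewrite wE' headstepE -?wE' ?mulgA //; split.
- by rewrite wE'; exact: lediv_mulr.
- by rewrite -mulgA.
move=> w' w'w; rewrite -mulgA => sw'.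
apply: (@sqf_lediv_cancel v); first exact: sqf_mulr sy1.
apply: max2 => //; apply: lediv_mul2l; apply: max1 => //; exact: sqf_mulr sw'.
Qed.

Lemma headstep1 p : sqf p.1 -> headstep 1 p = p.
Proof.
case: p => w y /= sw; rewrite -{1}(mulg1 w) headstepE ?mul1g ?mulg1 //.
by split=> //; rewrite ?mul1g //; apply: lediv_refl.
Qed.

Lemma sqf_headstep v p : sqf v -> sqf p.1 -> sqf (headstep v p).1.
Proof.
case: p => w y sv sw.
by have [w1 [w2 [_ [_ ? _] ->]]] := headstep_ex y sv (sw : sqf w).
Qed.

Lemma sqf_gen s : sqf (gen s).
Proof.
move=> y z t /(congr1 at_len); rewrite !at_lenM !at_len_gen; lia.
Qed.

Definition run u p : A * A := foldr (fun s => headstep (gen s)) p u.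

Lemma sqf_run u p : sqf p.1 -> sqf (run u p).1.
Proof. by move=> sp; elim: u => //= s u IH; apply: sqf_headstep => //; apply: sqf_gen. Qed.

Lemma run_sqf u p : sqf (cls u) -> sqf p.1 -> run u p = headstep (cls u) p.
Proof.
elim: u => [|s u IH]; first by move=> _ sp; rewrite at_class_nil headstep1.
rewrite at_class_cons => su sp.
by rewrite /= IH //; [apply: headstep_cons|apply: sqf_mulr su].
Qed.

Lemma run_cat u u' p : run (u ++ u') p = run u (run u' p).
Proof. by rewrite /run foldr_cat. Qed.

Lemma sqf_alt_order a b m : a != b -> ell a b = Some m -> sqf (alt a b m).
Proof.
move=> nab E; rewrite -[alt _ _ _]mul1g; apply: sqf_mul_alt => //; first exact: sqf1.
- by move=> [y /esym/at_mul_eq1 [_ /(congr1 at_len)]]; rewrite at_len_gen at_len1.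
- by move=> [y /esym/at_mul_eq1 [_ /(congr1 at_len)]]; rewrite at_len_gen at_len1.
- by rewrite /le_order E.
Qed.

Lemma run_braid_eq u u' p : sqf p.1 -> braid_eq ell u u' -> run u p = run u' p.
Proof.
move=> sp E; elim: E p sp => [a b n u1 u2 nab lab|//|u1 u2 _ IH|u1 u2 u3 _ IH1 _ IH2] p sp.
- rewrite !run_cat; congr run.
  have s2 : sqf (run u2 p).1 by apply: sqf_run.
  have sE := sqf_alt_order nab lab.
  move: (run u2 p) s2 => q s2; rewrite !run_sqf //; first by congr headstep; apply: alt_braid.
  by rewrite -/(alt b a n) -(alt_braid nab lab).
- by rewrite IH.
- by rewrite IH1 // IH2.
Qed.

Definition head_act x p := run (word_repr x) p.

Lemma head_act_class u p : sqf p.1 -> head_act (cls u) p = run u p.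
Proof. by move=> sp; apply: (at_lift_class (f := fun u => run u p)) => ? ?; apply: run_braid_eq. Qed.

Lemma sqf_head_act x p : sqf p.1 -> sqf (head_act x p).1.
Proof. exact: sqf_run. Qed.

Lemma head_actM x y p : sqf p.1 -> head_act (x * y) p = head_act x (head_act y p).
Proof.
move=> sp; have [[u ->] [u' ->]] := (at_class_surj x, at_class_surj y).
by rewrite at_mulgE !head_act_class ?run_cat //; apply: sqf_run.
Qed.

Lemma head_act_sqf v p : sqf v -> sqf p.1 -> head_act v p = headstep v p.
Proof.
have [u ->] := at_class_surj v => sv sp.
by rewrite head_act_class // run_sqf.
Qed.

Definition shead x := (head_act x (1, 1)).1.
Definition stail x := (head_act x (1, 1)).2.

Let sqf11 : sqf (1 : A, 1 : A).1. Proof. exact: sqf1. Qed.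

Lemma sqf_shead x : sqf (shead x).
Proof. exact: sqf_head_act. Qed.

Lemma shead_sqf_mul v y : sqf v -> exists w1 w2,
  [/\ shead y = w1 * w2, shead (v * y) = v * w1 & stail (v * y) = w2 * stail y].
Proof.
move=> sv; rewrite /shead /stail head_actM // (head_act_sqf sv (sqf_head_act (x:=y) sqf11)).
have [w1 [w2 [E _]]] := headstep_ex (stail y) sv (sqf_shead (x:=y)).
by rewrite /shead /stail -surjective_pairing => ->; exists w1, w2.
Qed.

Lemma shead_stail x : x = shead x * stail x.
Proof.
elim/at_indl: x => [|s x IH].
  by rewrite /shead /stail (head_act_sqf sqf1 sqf11) headstep1 ?mulg1.
have [w1 [w2 [E -> ->]]] := shead_sqf_mul x (sqf_gen (s:=s)).
by rewrite {1}IH E !mulgA.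
Qed.

Lemma shead_max v x : sqf v -> lediv_l v x -> lediv_l v (shead x).
Proof.
by move=> sv [y ->]; have [w1 [w2 [_ -> _]]] := shead_sqf_mul y sv; exact: lediv_mulr.
Qed.

Lemma shead_lediv x : lediv_l (shead x) x.
Proof. by exists (stail x); exact: shead_stail. Qed.

(** For a letter [s], the pair attached to [s x] determines [x]: its first
    component is [s w1], its second is the remainder of [x] enlarged by [w2],
    and the square-free head of [x] is [w1 w2]. *)
Theorem at_mulI v x y : v * x = v * y -> x = y.
Proof.
elim/at_indl: v x y => [|s v IH] x y; first by rewrite !mul1g.
rewrite -!mulgA => E; apply: IH; move: (v * x) (v * y) E => {}x {}y E.
have [w1 [w2 [xE hx tx]]] := shead_sqf_mul x (sqf_gen (s:=s)).
have [w3 [w4 [yE hy ty]]] := shead_sqf_mul y (sqf_gen (s:=s)).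
have w13 : w1 = w3.
  by apply: (@sqf_mulIl (gen s)); rewrite -?hx ?E // -?hy //; apply: sqf_shead.
rewrite (shead_stail x) (shead_stail y) xE yE -!mulgA -tx -ty E.
by rewrite w13.
Qed.

Theorem at_mulIr v x y : x * v = y * v -> x = y.
Proof.
move=> /(congr1 at_rev); rewrite !at_revM // => /at_mulI.
by move=> /(congr1 at_rev); rewrite !at_revK.
Qed.

Lemma lediv_cancel v x y : lediv_l (v * x) (v * y) -> lediv_l x y.
Proof. by move=> [p]; rewrite -mulgA => /at_mulI ->; exists p. Qed.

Theorem at_bounded_join m x y : lediv_l x m -> lediv_l y m ->
  exists k, is_join [set x; y]%classic k.
Proof.
move=> xm ym.
have [|||k [xk yk kmin]] := @bounded_lub_in setT atom_join _ _ _ m x y I xm ym => //.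
- by move=> v x' y' _; apply: at_mulI.
- move=> m' s t _ st sm' tm'.
  have [sD tD DE] := sqf_atom_join (sqf_shead (x:=m')) st (shead_max (sqf_gen (s:=s)) sm')
    (shead_max (sqf_gen (s:=t)) tm').
  by split=> //; apply: lediv_trans DE (shead_lediv _).
exists k; split=> [z [->|->]|m' H] //.
by apply: kmin => //; apply: H; [left|right].
Qed.

Lemma sqf_join x y k : sqf x -> sqf y -> is_join [set x; y]%classic k -> sqf k.
Proof.
move=> sx sy [ub lb]; apply: sqf_lediv (sqf_shead (x:=k)); apply: lb => z [->|->].
  by apply: shead_max => //; apply: ub; left.
by apply: shead_max => //; apply: ub; right.
Qed.

End Head.

(** * Gates *)
Section Gates.
Local Open Scope group_scope.
Implicit Types (a b s t r : Sigma) (c g j k v w x y z q : A).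

(** This preorder is coarser than reverse divisibility ([lediv_lmult_sub]) and
    compatible with left multiplication, which makes gates closed under
    suffixes. *)
Definition lmult_sub x y : Prop := forall v, sqf (v * x) -> sqf (v * y).

Lemma lmult_sub_trans y x z : lmult_sub x y -> lmult_sub y z -> lmult_sub x z.
Proof. by move=> xy yz v /xy /yz. Qed.

Lemma lediv_lmult_sub x y : lediv_l x y -> lmult_sub y x.
Proof. by move=> [p ->] v; rewrite mulgA => /sqf_mull. Qed.

Lemma exchange_rdesc g r a : sqf (gen r * g) -> ~ rdesc g a -> rdesc (gen r * g) a ->
  gen r * g = g * gen a.
Proof.
move=> srg na [y E]; apply: sqf_exchange => //.
  by apply: sqf_rcons => //; apply: sqf_mulr srg.
by rewrite E => H; apply: (H y 1 a); rewrite mulg1.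
Qed.

(** The elements [c * alt b a m] and [c * alt b a m.+1] bound a top edge of the
    rank-two polygon above [c]. If they have the same left multipliers, then no
    product [q * c] at the bottom of its own polygon can be left multiplied
    into the direction [a] ([no_exit]). So left multiplication of [c] moves its
    polygon only in the direction [b], at most once, and the other chain of the
    polygon stays square-free. *)
Lemma polygon_forcing c a b m : a != b -> ell a b = Some m.+1 ->
  ~ rdesc c a -> ~ rdesc c b ->
  lmult_sub (c * alt b a m) (c * alt b a m.+1) -> lmult_sub c (c * alt a b m).
Proof.
move=> nab E nca ncb H.
have nba : b != a by rewrite eq_sym.
have Eb : ell b a = Some m.+1 by rewrite ell_sym.
have top g : sqf g -> ~ rdesc g a -> ~ rdesc g b -> sqf (g * alt a b m.+1).
  by move=> *; apply: sqf_mul_alt => //; rewrite /le_order E.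
have no_exit q r : sqf (q * c) -> ~ rdesc (q * c) a -> ~ rdesc (q * c) b ->
    gen r * (q * c) <> q * c * gen a.
  move=> sq na nb rE.
  have : sqf ((gen r * q) * (c * alt b a m)).
    have -> : (gen r * q) * (c * alt b a m) = q * c * alt a b m.+1; last exact: top.
    by rewrite altS [RHS]mulgA -rE !mulgA.
  move=> /H; have -> : (gen r * q) * (c * alt b a m.+1) = q * c * gen a * gen a * alt b a m.
    by rewrite -(alt_braid nab E) altS -rE !mulgA -(mulgA (gen r)) rE.
  by move=> H'; apply: (H' (q * c) (alt b a m) a).
have key v : sqf (v * c) -> exists q, [/\ sqf (q * c), ~ rdesc (q * c) a,
    ~ rdesc (q * c) b & v * c = q * c \/ v * c = q * c * gen b].
  elim/at_indl: v => [|r v IH].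
    by rewrite mul1g => sc; exists 1; rewrite mul1g; split=> //; left.
  rewrite -mulgA => srv; have [q [sq na nb vE]] := IH (sqf_mulr srv).
  have srq : sqf (gen r * (q * c)).
    by case: vE srv => -> //; rewrite mulgA => /sqf_mull.
  have nra : ~ rdesc (gen r * (q * c)) a.
    by move=> /(exchange_rdesc srq na); apply: no_exit.
  have [rb|nrb] := pselect (rdesc (gen r * (q * c)) b).
    case: vE => vE; first by exists q; split=> //; right; rewrite vE; apply: exchange_rdesc.
    by move: srv; rewrite vE mulgA => /sqf_rdesc.
  exists (gen r * q); rewrite -mulgA; split => //.
  by case: vE => ->; [left|right; rewrite -[RHS]mulgA].
move=> v /key [q [sq na nb [vE|vE]]]; rewrite mulgA vE.
  by have := top _ sq na nb; rewrite altSr mulgA => /sqf_mull.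
rewrite -mulgA -altS; apply: sqf_mul_alt => //.
by rewrite /le_order Eb.
Qed.

(** In lattice terms, equality of left multipliers is a congruence for meets
    below [j]: [polygon_forcing] is the local case, and two applications of the
    induction hypothesis, below the two coatoms of a polygon, propagate it. *)
Lemma lmult_sub_meet j x y : sqf j -> lediv_l x j -> lediv_l y j -> lmult_sub y j ->
  exists z, [/\ lediv_l z x, lediv_l z y & lmult_sub z x].
Proof.
have [n] := ubnP (at_len j); elim: n j x y => // n IH j x y jn sj [p xp] [q yq] yj.
have [q1|[q' [s q'E]]] := at_caser q.
  exists x; split; [exact: lediv_refl| |by []].
  by exists p; rewrite -xp yq q1 mulg1.
have [p1|[p' [t p'E]]] := at_caser p.
  exists y; split; [|exact: lediv_refl|by rewrite -(mulg1 x) -p1 -xp].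
  by exists q; rewrite -yq xp p1 mulg1.
pose j1 := y * q'; pose j2 := x * p'.
have j1E : j = j1 * gen s by rewrite yq q'E mulgA.
have j2E : j = j2 * gen t by rewrite xp p'E mulgA.
have y1 : lediv_l y j1 by exact: lediv_mulr.
have x2 : lediv_l x j2 by exact: lediv_mulr.
have lc_y1 : lmult_sub y j1.
  by apply: lmult_sub_trans yj _; apply: lediv_lmult_sub; exists (gen s).
have lc_1j : lmult_sub j1 j by apply: lmult_sub_trans yj; apply: lediv_lmult_sub.
have sj1 : sqf j1 by move: sj; rewrite j1E => /sqf_mull.
have sj2 : sqf j2 by move: sj; rewrite j2E => /sqf_mull.
have j1n : (at_len j1 < n)%N by move: jn; rewrite j1E at_lenM at_len_gen; lia.
have j2n : (at_len j2 < n)%N by move: jn; rewrite j2E at_lenM at_len_gen; lia.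
have [st|st] := eqVneq s t.
  have j12 : j1 = j2 by apply: (@at_mulIr (gen s)); rewrite -j1E j2E st.
  by apply: (IH j1) => //; rewrite j12.
have [m [c [E jE ncs nct]]] : exists m c, [/\ ell s t = Some m, j = c * alt s t m,
    ~ rdesc c s & ~ rdesc c t] by apply: two_rdesc => //; [exists j1|exists j2].
have : exists m' a b, [/\ a != b, ell a b = Some m'.+1, ~ rdesc c a, ~ rdesc c b &
    [/\ j = c * alt b a m'.+1, j1 = c * alt b a m' & j2 = c * alt a b m']].
  have := ell_ge2 E; case: m E jE => // m E jE _; exists m.
  have jE' : j = c * alt t s m.+1 by rewrite jE (alt_braid st E).
  have E' : ell t s = Some m.+1 by rewrite ell_sym.
  case: (boolP (odd m)) => om; [exists s, t|exists t, s]; split => //; try by rewrite eq_sym.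
    split => //; [apply: (@at_mulIr (gen s))|apply: (@at_mulIr (gen t))].
      by rewrite -j1E jE' altSr /nxt om mulgA.
    by rewrite -j2E jE altSr /nxt om mulgA.
  split => //; [apply: (@at_mulIr (gen s))|apply: (@at_mulIr (gen t))].
    by rewrite -j1E jE altSr /nxt (negbTE om) mulgA.
  by rewrite -j2E jE' altSr /nxt (negbTE om) mulgA.
move=> [m' [a [b [nab Eab nca ncb [jE' j1E' j2E']]]]].
have lc_c2 : lmult_sub c j2.
  by rewrite j2E'; apply: polygon_forcing => //; rewrite -jE' -j1E'.
have c2 : lediv_l c j2 by rewrite j2E'; exact: lediv_mulr.
have [z [zx zc lz]] := IH j2 x c j2n sj2 x2 c2 lc_c2.
have z1 : lediv_l z j1 by apply: lediv_trans zc _; rewrite j1E'; exact: lediv_mulr.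
have [z' [z'z z'y lz']] := IH j1 z y j1n sj1 z1 y1 lc_y1.
exists z'; split=> //; [exact: lediv_trans zx|exact: lmult_sub_trans lz].
Qed.

(** For [y] a prefix of [x], [lmult_sub y x] says that [x] and [y] have the same
    left multipliers, the other inclusion being automatic. *)
Definition gate x : Prop :=
  sqf x /\ forall y, lediv_l y x -> lmult_sub y x -> y = x.

Lemma garside_gate : garside_subset (gate : set A).
Proof.
split=> [s|x y m [sx gx] [sy gy] xym|x y [z ->] [sz gz]].
- split=> [|y yx]; first exact: sqf_gen.
  have [->|[s' [y' E]]] := at_casel y.
    move=> /(_ (gen s)); rewrite mulg1 => /(_ (@sqf_gen _)) H.
    by case: (H 1 1 s); rewrite mulg1 mul1g.
  move=> _; apply: lediv_len_eq yx _.
  by rewrite E at_lenM !at_len_gen.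
- have sm := sqf_join sx sy xym; split=> // w wm lw; case: xym => ub lb.
  have xm : lediv_l x m by apply: ub; left.
  have ym : lediv_l y m by apply: ub; right.
  apply: lediv_anti => //; apply: lb => _ [->|->].
    by have [z [zx zw lz]] := lmult_sub_meet sm xm wm lw; rewrite -(gx z zx lz).
  by have [z [zx zw lz]] := lmult_sub_meet sm ym wm lw; rewrite -(gy z zx lz).
- split=> [|w wx lw]; first exact: sqf_mulr sz.
  apply: (at_mulI (v := z)); apply: gz; first exact: lediv_mul2l.
  by move=> v; rewrite !mulgA; apply: lw.
Qed.

Lemma at_gcd x y : exists g, [/\ lediv_l g x, lediv_l g y
  & forall z, lediv_l z x -> lediv_l z y -> lediv_l z g].
Proof.
pose Q (n : nat) := exists g, [/\ lediv_l g x, lediv_l g y & at_len g = n].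
have exQ : exists n, `[< Q n >].
  by exists 0%N; apply/asboolP; exists 1; rewrite at_len1; split=> //; exact: lediv1.
have ubQ n : `[< Q n >] -> (n <= at_len x)%N.
  by move=> /asboolP [w1 [/lediv_len + _ <-]].
have [k /asboolP [g [gx gy <-]] kmax] := ex_maxnP exQ ubQ.
exists g; split=> // z zx zy; have [j [ub lb]] := at_bounded_join gx zx.
have gj : lediv_l g j by apply: ub; left.
have zj : lediv_l z j by apply: ub; right.
suff -> : g = j by [].
apply: lediv_len_eq gj _; apply: kmax; apply/asboolP; exists j; split=> //.
  by apply: lb => _ [->|->].
by apply: lb => _ [->|->].
Qed.

(** In the Coxeter group this is the cone type of [v]. *)
Definition right_cone v : set A := [set z | sqf (v * z)].

Definition is_cone_min (T1 T2 : set A) z : Prop :=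
  [/\ T1 z, ~ T2 z & forall z', T1 z' -> ~ T2 z' -> lediv_l z z'].

(** Here [z] is the complement of [v] in the join of [v] and [gen r]. Expressed
    through right cones alone, it takes finitely many values when they do. *)
Definition cone_mins : set A := [set z | exists v r,
  [/\ sqf v, sqf (gen r * v) & is_cone_min (right_cone v) (right_cone (gen r * v)) z]].

(** Since [y] and [x] do not have the same left multipliers, there is a shortest
    [r v'] that is allowed for [y] and not for [x]. Then [r] is a prefix of
    [v' x], and the least [z] for which it is a prefix of [v' z] divides [x] but
    not [y]. *)
Lemma gate_cone_min x y s : gate x -> x = y * gen s ->
  exists z, [/\ cone_mins z, lediv_l z x & ~ lediv_l z y].
Proof.
move=> [sx gx] xE.
have yx : lediv_l y x by rewrite xE; exact: lediv_mulr.
have nyx : y <> x.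
  by move=> /(congr1 at_len); rewrite xE at_lenM at_len_gen; lia.
have /existsNP [v /not_implyP [svy nvx]] : ~ lmult_sub y x by move=> /(gx _ yx).
have [r [v' [srvy svx nrvx]]] : exists r v', [/\ sqf (gen r * v' * y),
    sqf (v' * x) & ~ sqf (gen r * v' * x)].
  elim/at_indl: v svy nvx => [|r v IH]; first by rewrite !mul1g.
  move=> svy nvx; have [svx|nvx'] := pselect (sqf (v * x)); first by exists r, v.
  by apply: IH => //; move: svy; rewrite -mulgA => /sqf_mulr.
have rvx : ldesc (v' * x) r.
  by apply: contrapT => /(sqf_cons svx); rewrite mulgA.
have srv := sqf_mull srvy.
have [k [ub lb]] := at_bounded_join rvx (lediv_mulr v' x).
have [z kE] : lediv_l v' k by apply: ub; right.
have rk : ldesc (v' * z) r by rewrite -kE; apply: ub; left.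
have kmin w : ldesc (v' * w) r -> lediv_l z w.
  move=> rw; apply: (@lediv_cancel v'); rewrite -kE; apply: lb => _ [->|->] //.
  exact: lediv_mulr.
have zx := kmin x rvx.
exists z; split=> //; last first.
  move=> /(lediv_mul2l v') zy; apply: (@sqf_ldesc (v' * y) r).
    by rewrite mulgA.
  exact: lediv_trans rk zy.
exists v', r; split=> //; first exact: sqf_mulr srv.
split=> [| |z']; first by apply: sqf_lediv svx; apply: lediv_mul2l.
  by rewrite /right_cone /= -mulgA => /sqf_ldesc.
rewrite /right_cone /= => svz nrvz; apply: kmin.
by apply: contrapT => /(sqf_cons svz); rewrite mulgA.
Qed.

(** If the greatest common prefix of [x] and [m] were proper in [x], it would
    omit a last letter of [x], and with it one of the prefixes provided by
    [gate_cone_min]. *)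
Lemma gate_le x m : gate x ->
  (forall z, cone_mins z -> lediv_l z x -> lediv_l z m) -> lediv_l x m.
Proof.
move=> gx H; have [g [gx' gm gmax]] := at_gcd x m.
case: (gx') => p xE; have [p1|[p' [s p'E]]] := at_caser p.
  by rewrite xE p1 mulg1.
have {p'E}xE : x = g * p' * gen s by rewrite xE p'E mulgA.
have [z [zc zx nz]] := gate_cone_min gx xE; case: nz.
by apply: lediv_trans (gmax z zx (H z zc zx)) (lediv_mulr _ _).
Qed.

Lemma finite_gate : finite_set [set right_cone v | v in [set v | sqf v]] ->
  finite_set (gate : set A).
Proof.
move=> fT; set Ts := [set right_cone v | v in _] in fT.
have fX : finite_set cone_mins.
  pose f (p : set A * set A) := xget 1 [set z | is_cone_min p.1 p.2 z].
  apply: (@sub_finite_set _ _ (f @` (Ts `*` Ts))); last first.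
    by apply: finite_image; apply: finite_setX.
  move=> z [v [r [sv srv zmin]]].
  exists (right_cone v, right_cone (gen r * v)).
    by split=> /=; [exists v|exists (gen r * v)].
  rewrite /f /=; case: xgetP => [z' _ [T1z' T2z' min']|/(_ z)] //.
  by case: zmin => T1z T2z minz; apply: lediv_anti; [apply: min'|apply: minz].
pose f (Z : set A) := xget 1 [set x | gate x /\ Z = cone_mins `&` [set z | lediv_l z x]].
apply: (@sub_finite_set _ _ (f @` [set Z | Z `<=` cone_mins])); last first.
  by apply: finite_image; apply: finite_powerset.
move=> x gx; exists (cone_mins `&` [set z | lediv_l z x]); first by move=> z [].
rewrite /f; case: xgetP => [x' _ [gx' ZE]|/(_ x) []//].
have E z : cone_mins z -> lediv_l z x <-> lediv_l z x'.
  move=> zc; have /(congr1 (fun Z : set A => Z z)) /= E := ZE.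
  split=> zx; first by have [] : cone_mins z /\ lediv_l z x' by rewrite -E.
  by have [] : cone_mins z /\ lediv_l z x by rewrite E.
by apply: lediv_anti; apply: gate_le => // z zc; rewrite E.
Qed.

End Gates.

(** * Small roots and the finiteness of right cones *)
Section SmallRoots.
Local Open Scope ring_scope.
Implicit Types (a b s t r : Sigma) (x y z g : A) (v w : V).

Definition root v : Prop := exists x s, v = act x (simple s).
Definition neg v : Prop := pos (- v).
Definition proot v : Prop := root v /\ pos v.

Lemma root_simple s : root (simple s).
Proof. by exists 1%g, s; rewrite act1. Qed.

Lemma root_act x v : root v -> root (act x v).
Proof. by move=> [y [s ->]]; exists (x * y)%g, s; rewrite actM. Qed.

Lemma root_refl s v : root v -> root (refl s v).
Proof. by rewrite -act_gen; apply: root_act. Qed.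

Lemma rootN v : root v -> root (- v).
Proof.
move=> [x [s ->]]; exists (x * gen s)%g, s.
by rewrite actM act_gen refl_simple actN.
Qed.

Lemma root_form v : root v -> form v v = 1.
Proof. by move=> [x [s ->]]; rewrite form_act form_simplexx. Qed.

Lemma root_pos_neg v : root v -> pos v \/ neg v.
Proof. by move=> [x [s ->]]; apply: root_sign. Qed.

Lemma pos_not_neg v : pos v -> ~ neg v.
Proof. exact: pos_neg. Qed.

Lemma root_nneg v : root v -> ~ neg v -> pos v.
Proof. by move=> /root_pos_neg []. Qed.

Lemma negN v : neg (- v) <-> pos v. Proof. by rewrite /neg opprK. Qed.

Lemma proot_simple s : proot (simple s).
Proof. by split; [exact: root_simple|exact: pos_simple]. Qed.

Lemma proot_refl_neg s v : proot v -> neg (refl s v) -> v = simple s.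
Proof. by move=> [/root_form v1 vp] vn; apply: pos_refl_neg v1 vp vn. Qed.

Lemma proot_refl s v : proot v -> v <> simple s -> proot (refl s v).
Proof.
move=> pv vs; split; first by apply: root_refl; case: pv.
apply: root_nneg => [|/(proot_refl_neg pv)//].
by apply: root_refl; case: pv.
Qed.

Definition ht v : R := \sum_s v s.

Lemma htD v w : ht (v + w) = ht v + ht w.
Proof. by rewrite /ht -big_split; apply: eq_bigr => s _; rewrite ffunE. Qed.

Lemma htZ (c : R) v : ht (c *: v) = c * ht v.
Proof. by rewrite /ht mulr_sumr; apply: eq_bigr => s _; rewrite ffunE. Qed.

Lemma htN v : ht (- v) = - ht v.
Proof. by rewrite -scaleN1r htZ mulN1r. Qed.

Lemma htB v w : ht (v - w) = ht v - ht w.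
Proof. by rewrite htD htN. Qed.

Lemma ht_simple s : ht (simple s) = 1.
Proof.
rewrite /ht (bigD1 s) //= simpleE eqxx big1 ?addr0 // => t ts.
by rewrite simpleE (negbTE ts).
Qed.

Lemma pos_ht v : pos v -> 0 < ht v.
Proof.
move=> [v0 vn]; rewrite lt_neqAle sumr_ge0 // andbT; apply/eqP => /esym/eqP.
rewrite psumr_eq0 // => /allP vz; apply: vn; apply/ffunP => s.
by rewrite ffunE; apply/eqP/vz; rewrite mem_index_enum.
Qed.

Lemma neg_ht v : neg v -> ht v < 0.
Proof. by move=> /pos_ht; rewrite htN oppr_gt0. Qed.

Lemma root_ht_pos v : root v -> 0 < ht v -> pos v.
Proof. by move=> /root_pos_neg [//|/neg_ht]; lra. Qed.

Definition inversions x : set V := [set v | proot v /\ neg (act x v)].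

Lemma finite_inversions x : finite_set (inversions x).
Proof.
elim/at_indl: x => [|s x IH].
  apply: (@sub_finite_set _ _ set0) => // v [[_ pv]].
  by rewrite act1 => /(pos_not_neg pv).
apply: (@sub_finite_set _ _ (inversions x `|` [set act (at_rev x) (simple s)])).
  move=> v [pv]; rewrite actM act_gen => nv.
  have rv : root (act x v) by apply: root_act; case: pv.
  case: (root_pos_neg rv) => [xp|xn]; last by left.
  by right; rewrite /= -(proot_refl_neg (conj rv xp) nv) act_revK.
by rewrite finite_setU; split=> //; exact: finite_set1.
Qed.

Lemma reflection_exists v : root v -> exists x, forall w, act x w = w - (2 * form w v) *: v.
Proof.
move=> [x [s ->]]; exists (x * gen s * at_rev x)%g => w.
rewrite !actM act_gen /refl actB act_revVK actZ; congr (_ - (2 * _) *: _).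
by rewrite -[in RHS](act_revVK x w) form_act.
Qed.

(** The roots [w], [v], then each time the opposite of the reflection of the
    previous one in the current one, run along the dihedral group of the two
    reflections, which is infinite as the product is at least 1. Their heights
    increase, so they stay positive, and the heights of their images under [x]
    strictly decrease from [w] on, so [x] inverts infinitely many of them. *)
Lemma root_chain_infinite v w x : root v -> root w -> 1 <= form v w ->
  pos v -> ht w <= ht v -> neg (act x v) -> pos (act x w) -> False.
Proof.
move=> rv rw c1 pv wv xv xw; pose c := form v w.
pose eps i : V := (iter i (fun p => (p.2, (2 * c) *: p.2 - p.1)) (w, v)).1.
have epsSS i : eps i.+2 = (2 * c) *: eps i.+1 - eps i by [].
have eps_root i : [/\ root (eps i), root (eps i.+1) & form (eps i) (eps i.+1) = c].
  elim: i => [|i [r1 r2 f]]; first by split=> //; rewrite /eps /= form_sym.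
  split=> //; last first.
    by rewrite epsSS formBr formZr (root_form r2) (form_sym _ (eps i)) f; ring.
  have [y yE] := reflection_exists r2.
  rewrite epsSS -opprB; apply: rootN; rewrite -f -yE.
  exact: root_act.
have eps_up i : ht (eps i) <= ht (eps i.+1) /\ 0 < ht (eps i.+1).
  elim: i => [|i [IH1 IH2]]; first by split=> //; apply: pos_ht.
  rewrite epsSS htB htZ; have : 0 <= (c - 1) * ht (eps i.+1).
    by rewrite mulr_ge0 // ?subr_ge0 // ltW.
  rewrite mulrBl mul1r => h.
  by split; rewrite -?mulrA; lra.
have eps_down i : ht (act x (eps i.+1)) < ht (act x (eps i)) /\ ht (act x (eps i.+1)) < 0.
  elim: i => [|i [IH1 IH2]].
    have h1 := neg_ht xv; have h2 := pos_ht xw.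
    by split=> //; rewrite /eps /=; lra.
  rewrite epsSS actB actZ htB htZ; have : 0 <= (c - 1) * - ht (act x (eps i.+1)).
    by rewrite mulr_ge0 // ?subr_ge0 // oppr_ge0 ltW.
  rewrite mulrBl mul1r mulrN => h.
  by split; rewrite -?mulrA; lra.
apply: (@finite_no_injection _ _ (fun i => eps i.+1) (finite_inversions x)).
  move=> i; have [_ r2 _] := eps_root i; have [_ h] := eps_up i.
  have [_ h'] := eps_down i; split; first by split=> //; apply: root_ht_pos.
  by apply: root_ht_pos; [apply/rootN/root_act|rewrite htN oppr_gt0].
have dec i j : (i < j)%N -> ht (act x (eps j)) < ht (act x (eps i)).
  elim: j => // j IH; rewrite ltnS leq_eqVlt => /orP [/eqP ->|/IH]; have [h _] := eps_down j => //.
  by move=> h'; apply: lt_trans h h'.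
move=> i j E; have [ij|ji|//] := ltngtP i j.
  by have := dec i.+1 j.+1 ij; rewrite E ltxx.
by have := dec j.+1 i.+1 ji; rewrite E ltxx.
Qed.

Definition dominates v w : Prop := forall x, neg (act x v) -> neg (act x w).

Definition small v : Prop := proot v /\ forall w, proot w -> dominates v w -> w = v.

Lemma dominates_trans w v u : dominates v w -> dominates w u -> dominates v u.
Proof. by move=> vw wu x /vw /wu. Qed.

Lemma dominates_anti v w : proot v -> proot w -> dominates v w -> dominates w v -> v = w.
Proof.
move=> pv pw vw wv; case: (pv) => [[x [s vE]] _].
have xv : act (at_rev x) v = simple s by rewrite vE act_revK.
have xw : proot (act (at_rev x) w).
  split; first by apply: root_act; case: pw.
  apply: root_nneg; first by apply: root_act; case: pw.
  by move=> /wv; rewrite xv; apply: pos_not_neg; apply: pos_simple.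
have : neg (act (gen s * at_rev x)%g v).
  by rewrite actM xv act_gen refl_simple negN; apply: pos_simple.
move=> /vw; rewrite actM act_gen => /(proot_refl_neg xw).
by rewrite -xv => /act_inj.
Qed.

Lemma proot_invertible v : proot v -> exists x, neg (act x v).
Proof.
move=> [[x [s ->]] _]; exists (gen s * at_rev x)%g.
by rewrite actM act_revK act_gen refl_simple negN; apply: pos_simple.
Qed.

(** The roots dominated by [v] are among the finitely many inversions of an
    element inverting [v]. *)
Lemma dominates_small v : proot v -> exists2 w, small w & dominates v w.
Proof.
pose D v : set V := [set w | proot w /\ dominates v w].
have fD u : proot u -> finite_set (D u).
  move=> /proot_invertible [x xu]; apply: sub_finite_set (finite_inversions x).
  by move=> w [pw uw]; split=> //; apply: uw.
have [n] := ubnP #|` fset_set (D v)|; elim: n v => // n IH v vn pv.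
have [sv|nsv] := pselect (small v); first by exists v.
have [w [pw vw nwv]] : exists w, [/\ proot w, dominates v w & w <> v].
  apply: contrapT => H; apply: nsv; split=> // w pw vw.
  by apply: contrapT => nwv; apply: H; exists w.
have wn : (#|` fset_set (D w)| < n)%N.
  apply: leq_trans (_ : (#|` fset_set (D v)| <= n)%N); last by [].
  apply: fproper_ltn_card; rewrite fproperE; apply/andP; split.
    apply/fsubsetP => u.
    rewrite !in_fset_set; try exact: fD.
    rewrite !inE.
    by move=> [pu wu]; split=> //; apply: dominates_trans vw wu.
  apply/fsubsetPn; exists v.
    by rewrite in_fset_set; [rewrite inE; split|exact: fD].
  rewrite in_fset_set; last exact: fD.
  by apply/negP; rewrite inE => -[_ wv]; apply: nwv; apply: dominates_anti.
have [u su wu] := IH w wn pw.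
by exists u => //; apply: dominates_trans wu.
Qed.

(** Of two positive roots with product at least 1, the higher one dominates the
    other. *)
Lemma small_form_lt1 v w : small v -> small w -> v <> w -> form v w < 1.
Proof.
move=> sv sw vw; rewrite ltNge; apply/negP => c1.
wlog wv : v w sv sw vw c1 / ht w <= ht v.
  move=> H; have /orP [wv|wv] := le_total (ht w) (ht v); first exact: (H v w).
  by apply: (H w v) => //; [exact: nesym|rewrite form_sym].
case: sv => [[rv pv] minv]; case: sw => [[rw pw] _].
apply: vw; apply/esym/minv => // x xv.
have [xw|//] := root_pos_neg (root_act x rw).
by case: (root_chain_infinite rv rw c1 pv wv xv xw).
Qed.

Lemma small_simple s : small (simple s).
Proof.
split=> [|w pw /(_ (gen s))]; first exact: proot_simple.
rewrite !act_gen refl_simple negN => /(_ (pos_simple _)).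
exact: proot_refl_neg.
Qed.

(** Since [form v v] is positive, some simple root with positive coefficient has
    positive product with [v]. After the reflection, a root dominated by
    [refl s v] is reflected back to one dominated by [v], except for [simple s]
    itself, which the reflection in [refl s v] keeps positive. *)
Lemma small_descent v : small v -> (exists s, v = simple s) \/
  exists s, [/\ 0 < form v (simple s), form v (simple s) < 1 & small (refl s v)].
Proof.
move=> sv; have [|ns] := pselect (exists s, v = simple s); first by left.
right; case: (sv) => [[rv pv] minv].
have [s fs] : exists s, 0 < form v (simple s).
  apply: contrapT => H; have : form v v <= 0.
    rewrite form_coord //; apply: sumr_le0 => s _; rewrite mulr_ge0_le0 //.
      by case: pv.
    by rewrite leNgt; apply/negP => h; apply: H; exists s.
  by rewrite root_form // ler10.
have vs : v <> simple s by move=> E; apply: ns; exists s.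
exists s; split=> //; first exact: small_form_lt1 (small_simple s) vs.
have pv' : proot (refl s v) by apply: proot_refl.
split=> // w pw dw; have [ws|/eqP ws] := eqVneq w (simple s).
  have [y yE] := reflection_exists pv'.1.
  have : neg (act y (refl s v)).
    rewrite yE root_form; last exact: pv'.1.
    rewrite mulr1 (_ : _ - _ = - refl s v) ?negN; first by case: pv'.
    by rewrite scaler_nat mulr2n opprD addNKr.
  move=> /dw; rewrite ws yE => neg_s; exfalso; apply: pos_not_neg neg_s.
  have -> : form (simple s) (refl s v) = - form v (simple s).
    by rewrite -{1}[simple s]opprK -(@refl_simple s) formNl form_refl form_sym.
  rewrite mulrN scaleNr opprK; split=> [t|/(congr1 ht)]; last first.
    have := mulr_gt0 fs (pos_ht pv'.2).
    by rewrite htD htZ ht_simple -[X in _ = ht X](scale0r v) htZ mul0r; lra.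
  case: pv'.2 => rv0 _; move: (refl s v) rv0 => u u0.
  rewrite ffunE; apply: addr_ge0; first by rewrite simpleE ler0n.
  by rewrite ffunE; apply: mulr_ge0; [rewrite mulr_ge0 // ltW|apply: u0].
rewrite -[w](@reflK s); congr refl; apply: minv; first exact: proot_refl.
move=> x; have := dw (x * gen s)%g; rewrite !actM !act_gen reflK; exact.
Qed.

Definition supported_roots (I : {set Sigma}) : set V :=
  [set v | root v /\ forall s, s \notin I -> v s = 0].

(** The products of two roots of a common finite standard parabolic
    subsystem. *)
Definition form_values : set R := \bigcup_(I in [set I | finite_set (supported_roots I)])
  [set form p.1 p.2 | p in supported_roots I `*` supported_roots I].

Lemma finite_form_values : finite_set form_values.
Proof.
apply: bigcup_finite; first exact: finite_finset.
by move=> I fI; apply: finite_image; apply: finite_setX.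
Qed.

Definition linear_form (f : V -> R) : Prop :=
  forall (c : R) v w, f (c *: v + w) = c * f v + f w.

Lemma vec_simple v : v = \sum_s v s *: simple s.
Proof.
apply/ffunP => t; rewrite sum_ffunE (bigD1 t) //= big1 => [|s st].
  by rewrite addr0 ffunE simpleE eqxx /GRing.scale /= mulr1.
by rewrite ffunE simpleE eq_sym (negbTE st) scaler0.
Qed.

Lemma linear_form0 f : linear_form f -> f 0 = 0.
Proof. by move=> lf; have := lf (-1) 0 0; rewrite scaler0 addr0 mulN1r addNr. Qed.

Lemma linear_formN f v : linear_form f -> f (- v) = - f v.
Proof.
by move=> lf; rewrite -[- v]addr0 -scaleN1r lf linear_form0 // addr0 mulN1r.
Qed.

Lemma linear_form_coord f v : linear_form f -> f v = \sum_s v s * f (simple s).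
Proof.
move=> lf; have f0 := linear_form0 lf.
rewrite {1}[v]vec_simple; elim/big_rec2: _ => [//|s y x _ <-].
by rewrite lf.
Qed.

(** A functional that is positive on almost all positive roots lies, up to the
    group, in the closed fundamental chamber: reflecting in a simple root where
    it is negative removes one positive root with negative value. For a dominant
    functional, the roots in its kernel are those supported on the simple roots
    it kills, and they are finitely many. *)
Lemma form_value_of_functional (f : V -> R) v w : linear_form f ->
  finite_set [set u | proot u /\ f u <= 0] -> root v -> root w ->
  f v = 0 -> f w = 0 -> form_values (form v w).
Proof.
pose N (f : V -> R) : set V := [set u | proot u /\ f u < 0].
pose Z (f : V -> R) : set V := [set u | proot u /\ f u <= 0].
have NZ f' : N f' `<=` Z f' by move=> u [pu /ltW].
have [n] := ubnP #|` fset_set (N f)|; elim: n f v w => // n IH f v w fn lf fZ rv rw fv fw.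
have fN := sub_finite_set (@NZ f) fZ.
have [[s fs]|H] := pselect (exists s, f (simple s) < 0).
  pose f' u := f (refl s u).
  have lf' : linear_form f' by move=> c u u'; rewrite /f' reflD reflZ lf.
  have sZ : Z f' `<=` refl s @` (Z f).
    move=> u [pu fu]; have [us|us] := pselect (u = simple s).
      by move: fu; rewrite us /f' refl_simple linear_formN // oppr_le0 leNgt fs.
    by exists (refl s u); [split=> //; apply: proot_refl|rewrite reflK].
  have fZ' : finite_set (Z f') by apply: sub_finite_set sZ _; apply: finite_image.
  rewrite -(form_refl s); apply: (IH f') => //; try exact: root_refl.
  - have fN' := sub_finite_set (@NZ f') fZ'.
    apply: leq_trans (_ : (#|` fset_set (N f)| <= n)%N); last by [].
    apply: leq_ltn_trans (_ : (#|` [fset refl s u | u in fset_set (N f) `\ simple s]%fset| < _)%N).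
      apply: fsubset_leq_card; apply/fsubsetP => u.
      rewrite in_fset_set // => /set_mem [pu fu].
      have us : u <> simple s.
        move=> us; move: fu; rewrite us /f' refl_simple linear_formN // oppr_lt0.
        by rewrite ltNge (ltW fs).
      apply/imfsetP; exists (refl s u); last by rewrite reflK.
      rewrite in_fsetD1 in_fset_set //; apply/andP; split.
        apply/eqP => E; case: (proot_refl pu us) => _; have := congr1 (refl s) E.
        rewrite reflK refl_simple => uE; case: pu => _ pu _.
        by apply: pos_not_neg pu _; rewrite uE negN; apply: pos_simple.
      by apply/mem_set; split=> //; apply: proot_refl.
    apply: leq_ltn_trans (leq_imfset_card _ _ _) _ => /=.
    apply: fproper_ltn_card; rewrite fproperE fsubD1set /=; apply/fsubsetPn.
    exists (simple s); last by rewrite !inE eqxx.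
    by rewrite in_fset_set //; apply/mem_set; split=> //; apply: proot_simple.
  - by rewrite /f' reflK.
  - by rewrite /f' reflK.
have f0 s : 0 <= f (simple s) by rewrite leNgt; apply/negP => fs; apply: H; exists s.
pose I := [set s | f (simple s) == 0]%SET.
have supp u : pos u -> f u = 0 -> forall s, s \notin I -> u s = 0.
  move=> [u0 _]; rewrite (linear_form_coord u lf) => /eqP.
  rewrite psumr_eq0 => [|s _]; last by rewrite mulr_ge0 ?u0.
  move=> /allP uf s; rewrite inE => sI; have := uf s (mem_index_enum _).
  by rewrite mulf_eq0 (negbTE sI) orbF => /eqP.
have fNE u := linear_formN u lf.
have inI u : root u -> f u = 0 -> supported_roots I u.
  move=> ru fu; split=> // s sI; have [pu|nu] := root_pos_neg ru; first exact: supp sI.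
  have := supp (- u) nu; rewrite fNE fu oppr0 => /(_ erefl s sI) /eqP.
  by rewrite ffunE oppr_eq0 => /eqP.
have fI : finite_set (supported_roots I).
  have supp0 (u : V) : (forall s, s \notin I -> u s = 0) -> f u = 0.
    move=> uI; rewrite (linear_form_coord u lf) big1 // => s _.
    have [|/uI ->] := boolP (s \in I); last by rewrite mul0r.
    by rewrite inE => /eqP ->; rewrite mulr0.
  apply: (@sub_finite_set _ _ (Z f `|` -%R @` (Z f))); last first.
    by rewrite finite_setU; split=> //; apply: finite_image.
  move=> u [ru uI]; have fu : f u = 0 by exact: supp0.
  have [pu|nu] := root_pos_neg ru; [left|right]; first by split=> //; rewrite fu.
  exists (- u); last by rewrite opprK.
  by split; [split=> //; apply: rootN|rewrite fNE fu oppr0].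
by exists I => //; exists (v, w) => //; split; apply: inI.
Qed.

(** The functional is the height composed with the orthogonal projection along
    the plane of [v] and [w], which is positive definite. It is invariant under
    the rotation [g] of this plane, and along the powers of [g] the height
    oscillates around it, so a positive root where it is nonpositive is inverted
    by one of finitely many powers of [g]. *)
Lemma form_value_root v w : root v -> root w -> -1 < form v w -> form v w < 1 ->
  form_values (form v w).
Proof.
move=> rv rw; set c := form v w => c1 c2.
have D0 : 1 - c ^+ 2 != 0 by apply: lt0r_neq0; rewrite subr_gt0; nra.
have fvv : form v v = 1 by apply: root_form.
have fww : form w w = 1 by apply: root_form.
have fwv : form w v = c by rewrite form_sym.
pose h u := ((form u v - c * form u w) / (1 - c ^+ 2)) * ht v +
            ((form u w - c * form u v) / (1 - c ^+ 2)) * ht w.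
pose f u := ht u - h u.
have lf : linear_form f.
  by move=> k u u'; rewrite /f /h htD htZ !formDl !formZl; field.
have fv : f v = 0 by rewrite /f /h fvv -/c; field.
have fw : f w = 0 by rewrite /f /h fww fwv; field.
have [x xE] := reflection_exists rv; have [y yE] := reflection_exists rw.
pose g : A := (x * y)%g.
have gE u : act g u = (u - (2 * form u w) *: w) - (2 * form (u - (2 * form u w) *: w) v) *: v.
  by rewrite actM yE xE.
have f_inv u : f (act g u) = f u.
  have fB v1 (k : R) v2 : f (v1 - k *: v2) = f v1 - k * f v2.
    by rewrite -scaleNr addrC lf mulNr addrC.
  by rewrite gE !fB fv fw !mulr0 !subr0.
have g_v u : form (act g u) v = - form u v + 2 * c * form u w.
  by rewrite gE !(formBl, formZl) fvv fwv; ring.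
have g_w u : form (act g u) w = - (2 * c) * form u v + (4 * c ^+ 2 - 1) * form u w.
  by rewrite gE !(formBl, formZl) fww fwv -/c; ring.
have h_rec u : h (act g (act g u)) = 2 * (2 * c ^+ 2 - 1) * h (act g u) - h u.
  by rewrite /h !(g_v, g_w); field.
have [K KP] := @rotation_sequence_nonpos R (2 * c ^+ 2 - 1) ltac:(nra).
apply: (form_value_of_functional (f := f)) => //.
apply: (@sub_finite_set _ _ (\bigcup_(k in `I_K.+1) inversions (g ^+ k)%g)); last first.
  by apply: bigcup_finite => // k _; apply: finite_inversions.
move=> u [pu fu].
have actX k : act (g ^+ k.+1)%g u = act g (act (g ^+ k)%g u) by rewrite expgS actM.
have f_invX k : f (act (g ^+ k)%g u) = f u.
  by elim: k => [|k IH]; rewrite ?expg0 ?act1 // actX f_inv.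
have [k|k kK hk] := KP (fun k => h (act (g ^+ k)%g u)); first by rewrite !actX h_rec.
exists k => //; split=> //.
have : ht (act (g ^+ k)%g u) <= 0.
  have := f_invX k; rewrite {1}/f => E.
  have -> : ht (act (g ^+ k)%g u) = f u + h (act (g ^+ k)%g u) by rewrite -E subrK.
  by rewrite -[X in _ <= X]addr0 lerD.
move=> hle; have ru : root (act (g ^+ k)%g u) by apply: root_act; case: pu.
by have [/pos_ht|//] := root_pos_neg ru; rewrite ltNge hle.
Qed.

Lemma finite_ffun_in (G : set R) : finite_set G ->
  finite_set [set f : {ffun Sigma -> R} | forall s, G (f s)].
Proof.
move=> fG; pose h (g : {ffun Sigma -> fset_set G}) : {ffun Sigma -> R} :=
  [ffun s => val (g s)].
apply: (@sub_finite_set _ _ (h @` setT)); last by apply: finite_image; apply: finite_finset.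
move=> f fP; have fG' s : f s \in fset_set G by rewrite in_fset_set //; apply: mem_set.
by exists [ffun s => [` fG' s]%fset] => //; apply/ffunP => s; rewrite !ffunE.
Qed.

(** Truncation at -1 makes the set of values finite. A letter used in a descent
    has product greater than -1 with the lower end, so the truncation hides
    nothing there. *)
Definition root_type v : {ffun Sigma -> R} := [ffun s => Num.max (-1) (form v (simple s))].

Lemma finite_root_types : finite_set [set root_type v | v in small].
Proof.
have fG : finite_set (form_values `|` [set 1; -1]).
  by rewrite finite_setU; split; [exact: finite_form_values|exact: finite_set2].
apply: sub_finite_set (finite_ffun_in fG) => _ [v sv <-] s; rewrite ffunE.
have [vs|/eqP vs] := eqVneq v (simple s).
  by right; left; rewrite vs form_simplexx; apply/max_idPr; lra.
have lt1 := small_form_lt1 sv (small_simple s) vs.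
have [le|gt] := lerP (form v (simple s)) (-1); first by right; right.
by left; apply: form_value_root => //; [case: sv => -[]|exact: root_simple].
Qed.

Lemma gram_le0 s t : s != t -> gram s t <= 0.
Proof.
rewrite /gram => /negbTE ->; case E: (ell s t) => [m|]; last by rewrite lerN10.
have m2 := ell_ge2 E; rewrite oppr_le0; apply: cos_ge0_pihalf.
have pi0 := pi_ge0 R; have m0 : (0 : R) < m%:R by rewrite ltr0n; lia.
apply/andP; split; first by apply: le_trans (_ : 0 <= _); rewrite ?oppr_le0 divr_ge0 // ltW.
by rewrite ler_pdivrMr // mulrAC ler_pdivlMr // ler_wpM2l // ler_nat.
Qed.

Definition descends v w : Prop := [/\ small v, small w & exists s,
  [/\ w = refl s v, 0 < form v (simple s) & form v (simple s) < 1]].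

Definition descendsb v w : bool := `[< descends v w >].

(** Going down, a step along [s] leaves a product greater than -1 with
    [simple s], and steps along other letters only increase it. So every letter
    used on the way has product greater than -1 with the last root. *)
Lemma descent_path v p : path descendsb v p ->
  [/\ forall s, (v - last v p) s != 0 -> -1 < form (last v p) (simple s),
      forall s, -1 < form v (simple s) -> -1 < form (last v p) (simple s)
    & ht (last v p) <= ht v /\ (p <> [::] -> ht (last v p) < ht v)].
Proof.
elim: p v => [|u p IH] v /=; first by split=> // s; rewrite subrr ffunE eqxx.
move=> /andP [/asboolP [_ _ [s [uE f0 f1]]] /IH [H1 H2 [H3 _]]].
have fu t : -1 < form v (simple t) -> -1 < form u (simple t).
  rewrite uE /refl formBl formZl form_simple2.
  have [<-|st] := eqVneq s t; first by rewrite gramxx; lra.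
  have g0 : 0 <= form v (simple s) * - gram s t by rewrite mulr_ge0 ?oppr_ge0 ?gram_le0 // ltW.
  by rewrite -mulrA; lra.
have fus : -1 < form u (simple s).
  by rewrite uE /refl formBl formZl form_simplexx; lra.
have htu : ht u < ht v by rewrite uE /refl htB htZ ht_simple; lra.
split=> [t|t /fu /H2|] //; last first.
  by split=> [|_]; [apply: ltW|]; apply: le_lt_trans htu.
have [->|ts] := eqVneq t s; first by move=> _; apply: H2.
move=> d; apply: H1; move: (last u p) d => w d.
by move: d; rewrite ffunE [in X in _ -> X]ffunE uE refl_neq.
Qed.

(** With equal types, the difference of the two roots is supported on simple
    roots to which it is orthogonal, hence isotropic, and the two roots have
    product 1, which [small_form_lt1] excludes. *)
Lemma descent_path_type v p : p <> [::] -> path descendsb v p -> small v ->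
  small (last v p) -> root_type v <> root_type (last v p).
Proof.
move=> p0 pp sv sw E; have [H1 _ [_ /(_ p0) hlt]] := descent_path pp.
move: (last v p) sw E H1 hlt => w sw E H1 hlt.
have vw : v <> w by move=> vw; move: hlt; rewrite vw ltxx.
have fE s : (v - w) s != 0 -> form (v - w) (simple s) = 0.
  move=> /H1 ws; have := congr1 (fun f : {ffun Sigma -> R} => f s) E; rewrite !ffunE.
  rewrite formBl (max_r (ltW ws)) => Es; apply/eqP; rewrite subr_eq0; apply/eqP.
  move: Es; have [le|gt] := lerP (form v (simple s)) (-1); last by [].
  by move=> wE; move: ws; rewrite -wE ltxx.
have : form (v - w) (v - w) = 0.
  rewrite form_coord // big1 // => s _.
  by have [->|/fE ->] := eqVneq ((v - w) s) 0; rewrite ?mul0r ?mulr0.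
have := small_form_lt1 sv sw vw; case: sv sw => [[rv _] _] [[rw _] _].
rewrite formBl !formBr (form_sym w v) !root_form //; lra.
Qed.

Lemma descent_path_uniq v p : small v -> path descendsb v p ->
  uniq [seq root_type u | u <- v :: p].
Proof.
elim: p v => // u p IH v sv pp; rewrite map_cons cons_uniq.
have [/asboolP [_ su _] pu] := andP (pp : descendsb v u && path descendsb u p).
apply/andP; split; last exact: IH.
apply/negP => /mapP [w wp]; case/splitPr: wp pp => p1 p2.
rewrite -cat_rcons cat_path => /andP [pp _] E.
have sw : small w.
  move: pp; rewrite rcons_path => /andP [_ /asboolP [_ sw _]] //.
apply: (@descent_path_type v (rcons p1 w)); rewrite ?last_rcons //.
by case: (p1).
Qed.

Fixpoint reach (n : nat) : set V := if n is n'.+1 then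
  reach n' `|` \bigcup_(s in [set: Sigma]) [set refl s v | v in reach n']
  else [set simple s | s in setT].

Lemma finite_reach n : finite_set (reach n).
Proof.
elim: n => [|n IH] /=; first by apply: finite_image; apply: finite_finset.
rewrite finite_setU; split=> //; apply: bigcup_finite; first exact: finite_finset.
by move=> s _; apply: finite_image.
Qed.

Lemma small_reach n v : small v ->
  reach n v \/ exists p, size p = n.+1 /\ path descendsb v p.
Proof.
elim: n v => [|n IH] v sv; have [[s vE]|[s [f0 f1 su]]] := small_descent sv.
- by left; exists s.
- by right; exists [:: refl s v]; split=> //=; rewrite andbT; apply/asboolP; split=> //; exists s.
- left; left; elim: (n) => [|k IHk]; [by exists s|by left].
have [ru|[p [sp pp]]] := IH _ su.
  by left; right; exists s => //; exists (refl s v); rewrite ?reflK.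
right; exists (refl s v :: p); split; first by rewrite /= sp.
by rewrite /= pp andbT; apply/asboolP; split=> //; exists s.
Qed.

Lemma finite_small : finite_set small.
Proof.
pose T := fset_set [set root_type v | v in small].
apply: sub_finite_set (finite_reach #|` T|) => v sv.
have [//|[p [sp pp]]] := small_reach #|` T| sv.
have : (size [seq root_type u | u <- v :: p] <= #|` T|)%N.
  apply: uniq_leq_size; first exact: descent_path_uniq.
  move=> _ /mapP [u up ->]; rewrite in_fset_set; last exact: finite_root_types.
  apply/mem_set; exists u => //.
  elim: p v sv up pp {sp} => [|w p IH] v sv; first by rewrite inE => /eqP ->.
  rewrite inE => /orP [/eqP -> //|up] /= /andP [/asboolP [_ sw _] pp].
  exact: IH up pp.
by rewrite size_map /= sp ltnNge leqnSn.
Qed.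

Lemma sqf_mul_inversions (v z : A) w : sqf (v * z)%g -> proot w -> neg (act v w) ->
  ~ neg (act (at_rev z) w).
Proof.
elim/at_indr: z => [|z t IH] svz [rw pw] vw.
  by rewrite at_rev1 act1; apply: pos_not_neg.
rewrite mulgA in svz; rewrite at_revM at_rev_gen actM act_gen => zw.
have pzw : proot (act (at_rev z) w).
  split; first exact: root_act.
  apply: root_nneg; first exact: root_act.
  by apply: IH => //; apply: sqf_mull svz.
have wE : w = act z (simple t) by rewrite -(proot_refl_neg pzw zw) act_revVK.
apply: pos_not_neg vw; rewrite wE -actM; apply: ndesc_pos; first exact: sqf_mull svz.
exact: sqf_rdesc.
Qed.

Lemma nsqf_mul_inversion (v z : A) : sqf v -> sqf z -> ~ sqf (v * z)%g ->
  exists2 w, proot w & neg (act v w) /\ neg (act (at_rev z) w).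
Proof.
move=> sv; elim/at_indr: z => [|z t IH] szt nvz; first by case: nvz; rewrite mulg1.
have sz := sqf_mull szt.
have [svz|nvz'] := pselect (sqf (v * z)%g); last first.
  have [w pw [vw zw]] := IH sz nvz'; exists w => //; split=> //.
  rewrite at_revM at_rev_gen actM act_gen.
  have rw : root (act (at_rev z) w) by apply: root_act; case: pw.
  have pw' : proot (- act (at_rev z) w) by split=> //; apply: rootN.
  have [pr|//] := root_pos_neg (root_refl t rw).
  have /(proot_refl_neg pw') E : neg (refl t (- act (at_rev z) w)).
    by rewrite -scaleN1r reflZ scaleN1r negN.
  case: (@pos_not_neg w) => //; first by case: pw.
  have -> : w = - act z (simple t) by rewrite -E actN opprK act_revVK.
  by rewrite negN; apply: ndesc_pos => //; apply: sqf_rdesc.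
exists (act z (simple t)).
  split; first by apply/root_act/root_simple.
  by apply: ndesc_pos => //; apply: sqf_rdesc.
split.
  rewrite -actM; apply: desc_neg => //; apply: contrapT => /(sqf_rcons svz).
  by rewrite -mulgA.
by rewrite at_revM at_rev_gen actM act_gen act_revK refl_simple negN; apply: pos_simple.
Qed.

(** [v * z] fails to be square-free exactly when some positive root is made
    negative both by [v] and by the reversal of [z], and a small root dominated
    by it has the same property. *)
Lemma right_cone_small (v : A) : sqf v -> right_cone v =
  [set z | sqf z /\ ~ exists w, [/\ small w, neg (act v w) & neg (act (at_rev z) w)]].
Proof.
move=> sv; apply/seteqP; split=> z /=.
  move=> svz; split; first exact: sqf_mulr svz.
  by move=> [w [[pw _] vw]]; apply: sqf_mul_inversions svz pw vw.
move=> [sz H]; apply: contrapT => nvz.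
have [w pw [vw zw]] := nsqf_mul_inversion sv sz nvz.
have [u su wu] := dominates_small pw.
by apply: H; exists u; split=> //; apply: wu.
Qed.

Theorem finite_right_cones : finite_set [set right_cone v | v in [set v : A | sqf v]].
Proof.
pose F (N : set V) : set A := [set z | sqf z /\ ~ exists w, N w /\ neg (act (at_rev z) w)].
apply: (@sub_finite_set _ _ (F @` [set N | N `<=` small])); last first.
  by apply: finite_image; apply: finite_powerset; apply: finite_small.
move=> _ [v sv <-]; exists (small `&` [set w | neg (act v w)]); first by move=> w [].
rewrite right_cone_small //; apply/seteqP; split=> z [sz H]; split=> // -[w].
  by move=> [sw vw zw]; apply: H; exists w.
by move=> [[sw vw] zw]; apply: H; exists w.
Qed.

End SmallRoots.

(** * Normal forms over the smallest Garside subset *)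
Section GarsideNormalForms.
Local Open Scope group_scope.
Local Notation S := (@garside_S Sigma ell).
Implicit Types (r : Sigma) (h k m p q s u v w x y z : A) (n i j : nat).

Lemma garside_S_gate : S `<=` gate.
Proof. by move=> x; apply; apply: (garside_gate). Qed.

Lemma finite_garside_S : finite_set S.
Proof.
apply: (sub_finite_set garside_S_gate).
have := finite_right_cones; exact: finite_gate.
Qed.

Lemma garside_S_gen r : S (gen r).
Proof. by move=> G [gG _ _]; apply: gG. Qed.

Lemma garside_S_join x y m : S x -> S y -> is_join [set x; y] m -> S m.
Proof.
move=> Sx Sy xym G gG; case: (gG) => _ jG _; apply: jG xym; [exact: Sx|exact: Sy].
Qed.

Lemma garside_S_suffix z x : S (z * x) -> S x.
Proof. by move=> Szx G gG; case: (gG) => _ _ sG; apply: (sG x (z * x)); [exists z|apply: Szx]. Qed.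

Lemma garside_S1 : S 1.
Proof.
by case/card_gt0P: Sigma_nonempty => r _; apply: (@garside_S_suffix (gen r)); rewrite mulg1;
  apply: garside_S_gen.
Qed.

Lemma is_join2 x y k : is_join [set x; y] k <->
  [/\ lediv_l x k, lediv_l y k & forall m, lediv_l x m -> lediv_l y m -> lediv_l k m].
Proof.
split=> [[ub lb]|[xk yk kmin]].
  by split; [apply: ub; left|apply: ub; right|move=> m xm ym; apply: lb => _ [->|->]].
by split=> [_ [->|->]|m H] //; apply: kmin; apply: H; [left|right].
Qed.

(** Closure under suffixes and joins makes S stable under taking the complement
    of any [x], not only of elements of S: peel off the letters of [x], each of
    which belongs to S. *)
Lemma garside_S_residue x s w : S s -> is_join [set x; s] (x * w) -> S w.
Proof.
elim/at_indl: x s => [|r x IH] s Ss /is_join2 [xk sk kmin].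
  rewrite mul1g in xk sk kmin; suff -> : w = s by [].
  by apply: lediv_anti => //; apply: kmin; [exact: lediv1|exact: lediv_refl].
have rk : lediv_l (gen r) (gen r * x * w) by rewrite -mulgA; exact: lediv_mulr.
have [k1 k1J] := at_bounded_join rk sk.
have Sk1 := garside_S_join (garside_S_gen r) Ss k1J.
case/is_join2: k1J => [[s1 k1E] sk1 k1min]; rewrite k1E in Sk1 sk1.
apply: (IH s1); first exact: garside_S_suffix Sk1.
apply/is_join2; split; first exact: lediv_mulr.
  by apply: (lediv_cancel (v := gen r)); rewrite mulgA -k1E; apply: k1min.
move=> m xm s1m; apply: (lediv_cancel (v := gen r)); rewrite mulgA.
apply: kmin; first exact: lediv_mul2l.
by apply: lediv_trans sk1 _; apply: lediv_mul2l.
Qed.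

Definition is_S_head x h : Prop :=
  [/\ S h, lediv_l h x & forall s, S s -> lediv_l s x -> lediv_l s h].

Lemma S_head_exists x : exists h, is_S_head x h.
Proof.
pose Q n := exists h, [/\ S h, lediv_l h x & at_len h = n].
have exQ : exists n, `[< Q n >].
  exists 0%N; apply/asboolP; exists 1; rewrite at_len1.
  by split=> //; [exact: garside_S1|exact: lediv1].
have ubQ n : `[< Q n >] -> (n <= at_len x)%N.
  by move=> /asboolP [h [_ /lediv_len + <-]].
have [n /asboolP [h [Sh hx <-]] nmax] := ex_maxnP exQ ubQ.
exists h; split=> // s Ss sx; have [k kJ] := at_bounded_join hx sx.
have Sk := garside_S_join Sh Ss kJ; case/is_join2: kJ => hk sk kmin.
suff -> : h = k by [].
apply: lediv_len_eq hk _; apply: nmax; apply/asboolP; exists k; split=> //.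
exact: kmin.
Qed.

Definition S_head x : A := xget 1 [set h | is_S_head x h].
Definition S_tail x : A := xget 1 [set t | x = S_head x * t].

Lemma S_headP x : is_S_head x (S_head x).
Proof. by have [h hP] := S_head_exists x; apply: (@xgetPex _ 1 [set h | is_S_head x h]); exists h. Qed.

Lemma S_head_in x : S (S_head x). Proof. by case: (S_headP x). Qed.

Lemma S_head_max s x : S s -> lediv_l s x -> lediv_l s (S_head x).
Proof. by case: (S_headP x) => _ _; apply. Qed.

Lemma S_head_uniq x h : is_S_head x h -> S_head x = h.
Proof.
move=> [Sh hx hmax]; case: (S_headP x) => Sh' hx' hmax'.
by apply: lediv_anti; [apply: hmax|apply: hmax'].
Qed.

Lemma S_head_tail x : x = S_head x * S_tail x.
Proof. by case: (S_headP x) => _ h _; apply: (@xgetPex _ 1 [set t | x = S_head x * t]). Qed.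

Lemma S_head_neq1 x : x <> 1 -> S_head x <> 1.
Proof.
have [->|[r [y xE]] _ h1] := at_casel x; first by [].
have : lediv_l (gen r) (S_head x).
  by apply: S_head_max; [exact: garside_S_gen|exists y].
by rewrite h1 => /lediv_len; rewrite at_len_gen at_len1.
Qed.

(** The complement of [x] in the join of [x] and [s] lies in S and divides
    [y]. *)
Lemma lediv_mul_S_head s x y : S s -> lediv_l s (x * y) -> lediv_l s (x * S_head y).
Proof.
move=> Ss sxy; have [k kJ] := at_bounded_join (lediv_mulr x y) sxy.
case/is_join2: (kJ) => [[w kE] sk kmin]; rewrite kE in kJ.
have Sw := garside_S_residue Ss kJ.
apply: lediv_trans sk _; rewrite kE; apply/lediv_mul2l/S_head_max => //.
by apply: (lediv_cancel (v := x)); rewrite -kE; apply: kmin => //; exact: lediv_mulr.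
Qed.

Fixpoint S_pow n x : Prop :=
  if n is n'.+1 then exists y s, [/\ x = y * s, S_pow n' y & S s] else x = 1.

Lemma S_pow_widen n j x : (n <= j)%N -> S_pow n x -> S_pow j x.
Proof.
move=> /subnKC <-; elim: (j - n)%N => [|i IH]; first by rewrite addn0.
by rewrite addnS => /IH xn; exists x, 1; rewrite mulg1; split=> //; exact: garside_S1.
Qed.

Lemma finite_S_pow n : finite_set [set x | S_pow n x].
Proof.
elim: n => [|n IH] /=; first exact: finite_set1.
apply: (@sub_finite_set _ _ ((fun p : A * A => p.1 * p.2) @` ([set x | S_pow n x] `*` S))).
  by move=> _ [y [s [-> yn Ss]]]; exists (y, s).
by apply: finite_image; apply: finite_setX => //; exact: finite_garside_S.
Qed.

Definition rest n x : A := iter n S_tail x.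
(** The product of the first [n] factors of the normal form, with the form
    continued by 1 once exhausted. *)
Fixpoint pref n x : A := if n is n'.+1 then pref n' x * S_head (rest n' x) else 1.

Lemma pref_rest n x : x = pref n x * rest n x.
Proof.
elim: n => [|n IH]; first by rewrite mul1g.
by rewrite [pref _ _]/= -mulgA [rest n.+1 x]iterS -S_head_tail.
Qed.

Lemma pref_le n x : lediv_l (pref n x) x.
Proof. by rewrite {2}(pref_rest n x); exact: lediv_mulr. Qed.

Lemma pref_mono n j x : (n <= j)%N -> lediv_l (pref n x) (pref j x).
Proof.
move=> /subnKC <-; elim: (j - n)%N => [|i IH]; first by rewrite addn0; exact: lediv_refl.
by rewrite addnS; apply: lediv_trans IH (lediv_mulr _ _).
Qed.

Lemma S_pow_pref n x : S_pow n (pref n x).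
Proof. by elim: n => //= n IH; exists (pref n x), (S_head (rest n x)); split=> //; exact: S_head_in. Qed.

(** Writing [pref n y = x' z] and [x = x' s], the complement [w] of [z] in the
    join of [z] and [s] lies in S and can be appended to [pref n y] inside
    [y]. *)
Lemma pref_max n x y : S_pow n x -> lediv_l x y -> lediv_l x (pref n y).
Proof.
elim: n x => [|n IH] x /=; first by move=> -> _; exact: lediv1.
move=> [x' [s [-> x'n Ss]]] xy.
have x'y : lediv_l x' y by apply: lediv_trans xy; exact: lediv_mulr.
have [z hE] := IH x' x'n x'y.
have [p pE] := x'y; rewrite pE in xy; have sp := lediv_cancel xy.
have zp : lediv_l z p.
  by apply: (lediv_cancel (v := x')); rewrite -hE -pE; exact: pref_le.
have [k kJ] := at_bounded_join zp sp.
case/is_join2: (kJ) => [[w kE] sk kmin]; rewrite kE in kJ.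
have Sw := garside_S_residue Ss kJ.
apply: (@lediv_trans (pref n y * w)).
  by rewrite hE -mulgA -kE; apply: lediv_mul2l.
apply/lediv_mul2l/S_head_max => //.
apply: (lediv_cancel (v := pref n y)); rewrite -pref_rest hE -mulgA -kE pE.
by apply: lediv_mul2l; apply: kmin.
Qed.

Lemma S_pow_prefE n x : S_pow n x <-> pref n x = x.
Proof.
split=> [xn|<-]; last exact: S_pow_pref.
by apply: lediv_anti; [exact: pref_le|apply: pref_max => //; exact: lediv_refl].
Qed.

Lemma rest1 n : rest n 1 = 1.
Proof.
elim: n => [//|n]; rewrite /rest iterS => ->.
by have [] := at_mul_eq1 (esym (S_head_tail 1)).
Qed.

Lemma at_len_rest n x : rest n x <> 1 -> (at_len (rest n x) + n <= at_len x)%N.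
Proof.
elim: n => [|n IH]; first by rewrite addn0.
rewrite [rest n.+1 x]iterS -/(rest n x) => r1.
have rn1 : rest n x <> 1 by move=> E; apply: r1; rewrite E; exact: (rest1 1).
have := IH rn1; have := congr1 at_len (S_head_tail (rest n x)); rewrite at_lenM.
have : at_len (S_head (rest n x)) <> 0%N by move=> /at_len_eq0; apply: S_head_neq1.
lia.
Qed.

Lemma rest_eq1 n x : rest n x = 1 <-> pref n x = x.
Proof.
split=> [r1|px]; first by rewrite [RHS](pref_rest n) r1 mulg1.
by apply: (at_mulI (v := pref n x)); rewrite -pref_rest mulg1.
Qed.

Lemma rest_len x : rest (at_len x).+1 x = 1.
Proof. by apply: contrapT => /at_len_rest; lia. Qed.

Lemma S_height_exists x : exists n, (0 < n)%N && (pref n x == x).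
Proof. by exists (at_len x).+1; apply/eqP; rewrite -rest_eq1; exact: rest_len. Qed.

Definition S_height x : nat := ex_minn (S_height_exists x).

Lemma S_height_gt0 x : (0 < S_height x)%N.
Proof. by rewrite /S_height; case: ex_minnP => n /andP []. Qed.

Lemma pref_S_height x : pref (S_height x) x = x.
Proof. by rewrite /S_height; case: ex_minnP => n /andP [_ /eqP]. Qed.

Lemma S_height_min n x : (0 < n)%N -> S_pow n x -> (S_height x <= n)%N.
Proof.
move=> n0 /S_pow_prefE px; rewrite /S_height; case: ex_minnP => i _; apply.
by rewrite n0 px eqxx.
Qed.

Lemma S_height_le n x : (S_height x <= n)%N -> S_pow n x.
Proof. by move=> le; apply: S_pow_widen le _; apply/S_pow_prefE; exact: pref_S_height. Qed.

Definition S_heads n x : seq A := mkseq (fun i => S_head (rest i x)) n.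

Lemma prod_S_heads n x : \prod_(z <- S_heads n x) z = pref n x.
Proof.
elim: n => [|n IH]; first by rewrite big_nil.
by rewrite /S_heads mkseqS -cats1 big_cat big_seq1 -/(S_heads n x) IH.
Qed.

Lemma nf_arrow_S_head x : nf_arrow (S_head x) (S_head (S_tail x)).
Proof.
split=> [z [Sz zx]|m]; last first.
  by apply; split; [exact: S_head_in|exact: lediv_mulr].
apply: S_head_max => //; apply: lediv_trans zx _; rewrite [X in lediv_l _ X](S_head_tail x).
by apply: lediv_mul2l; rewrite [X in lediv_l _ X](S_head_tail (S_tail x)); exact: lediv_mulr.
Qed.

Lemma S_heads_normal_form x : is_normal_form x (S_heads (S_height x) x).
Proof.
rewrite /is_normal_form; case: eqP => [->|x1].
  have -> : S_height 1 = 1%N.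
    apply/eqP; rewrite eqn_leq S_height_gt0 andbT; apply: S_height_min => //.
    by exists 1, 1; rewrite mulg1; split=> //; exact: garside_S1.
  rewrite /S_heads /=; congr [:: _]; apply: S_head_uniq; split; first exact: garside_S1.
    exact: lediv_refl.
  by move=> s _ /lediv1_eq ->; exact: lediv_refl.
split.
- by rewrite size_mkseq S_height_gt0.
- by rewrite prod_S_heads pref_S_height.
- move=> z /mapP [i]; rewrite mem_iota add0n /= => ih ->; split; first exact: S_head_in.
  apply: S_head_neq1; case: i ih => [//|i] ih /rest_eq1 /S_pow_prefE /S_height_min.
  by move=> /(_ isT); rewrite leqNgt ih.
- apply/(sortedP 1) => i; rewrite size_mkseq => ih.
  rewrite !nth_mkseq //; last exact: ltnW.
  by apply/asboolP; rewrite /rest iterS; exact: nf_arrow_S_head.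
Qed.

Lemma S_head_sorted x (s : seq A) : (forall z, z \in x :: s -> S z) ->
  path (fun y z => `[< nf_arrow y z >]) x s -> S_head (\prod_(z <- x :: s) z) = x.
Proof.
elim: s x => [|y s IH] x Sxs /=.
  move=> _; rewrite big_seq1; apply: S_head_uniq; split=> //.
    by apply: Sxs; rewrite mem_head.
  exact: lediv_refl.
move=> /andP [/asboolP [ub lb] pys]; rewrite big_cons.
have Sys z : z \in y :: s -> S z by move=> zs; apply: Sxs; rewrite inE zs orbT.
have hE := IH y Sys pys.
apply: S_head_uniq; split; [by apply: Sxs; rewrite mem_head|exact: lediv_mulr|].
by move=> z Sz /(lediv_mul_S_head Sz); rewrite hE => zxy; apply: ub.
Qed.

Lemma normal_form_uniq x (s s' : seq A) : is_normal_form x s -> is_normal_form x s' -> s = s'.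
Proof.
rewrite /is_normal_form; case: eqP => [_ -> -> //|x1].
move=> [s0 xE Ss ps] [s0' xE' Ss' ps'].
have {x1 s0 s0'} : \prod_(z <- s) z = \prod_(z <- s') z by rewrite -xE.
have prod1 y (t : seq A) : (forall z, z \in y :: t -> S z /\ z <> 1) ->
    \prod_(z <- y :: t) z <> 1.
  move=> H; rewrite big_cons => /at_mul_eq1 [y1 _].
  by have [] := H y (mem_head _ _).
elim: s s' Ss ps Ss' ps' {xE xE'} => [|y s IH] [|y' s'] Ss ps Ss' ps' //.
- by rewrite big_nil => /esym /(prod1 _ _ Ss').
- by rewrite big_nil => /(prod1 _ _ Ss).
move=> E; have hE := S_head_sorted (fun z zs => (Ss z zs).1) ps.
have hE' := S_head_sorted (fun z zs => (Ss' z zs).1) ps'.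
have yy : y = y' by rewrite -hE E hE'.
subst y'; congr (_ :: _); apply: IH.
- by move=> z zs; apply: Ss; rewrite inE zs orbT.
- exact: path_sorted ps.
- by move=> z zs; apply: Ss'; rewrite inE zs orbT.
- exact: path_sorted ps'.
- by move: E; rewrite !big_cons => /at_mulI.
Qed.

Lemma normal_formE x : normal_form x = S_heads (S_height x) x.
Proof.
apply: (@normal_form_uniq x); last exact: S_heads_normal_form.
apply: (@xgetPex _ [::] [set s | is_normal_form x s]).
by exists (S_heads (S_height x) x); exact: S_heads_normal_form.
Qed.

Lemma height_S_height x : height x = S_height x.
Proof. by rewrite /height normal_formE size_mkseq. Qed.

Lemma prod_take_normal_form n x : (n <= height x)%N ->
  \prod_(z <- take n (normal_form x)) z = pref n x.
Proof.
rewrite height_S_height => nx; rewrite normal_formE -prod_S_heads /S_heads /mkseq -map_take.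
by rewrite take_iota (minn_idPl nx).
Qed.

Lemma height_gt0 x : (0 < height x)%N.
Proof. by rewrite height_S_height S_height_gt0. Qed.

Lemma height_leP n x : (0 < n)%N -> (height x <= n)%N <-> S_pow n x.
Proof.
by move=> n0; rewrite height_S_height; split; [exact: S_height_le|exact: S_height_min].
Qed.

Lemma S_pow_height x : S_pow (height x) x.
Proof. by apply/height_leP => //; exact: height_gt0. Qed.

Lemma bounded_join (X : set A) m : (forall x, X x -> lediv_l x m) -> has_join X.
Proof.
move=> Xm; pose Q n := exists k, (forall x, X x -> lediv_l x k) /\ at_len k = n.
have exQ : exists n, `[< Q n >] by exists (at_len m); apply/asboolP; exists m.
have [n /asboolP [k [Xk <-]] nmin] := ex_minnP exQ.
exists k; split=> // m' Xm'; have [g [gk gm gmax]] := at_gcd k m'.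
suff <- : g = k by [].
apply: lediv_len_eq gk _; apply: nmin; apply/asboolP; exists g; split=> // x Xx.
by apply: gmax; [apply: Xk|apply: Xm'].
Qed.

Lemma joinP (X : set A) : has_join X -> is_join X (join X).
Proof. by move=> [m mJ]; apply: (@xgetPex _ 1 [set m | is_join X m]); exists m. Qed.

Lemma S_pow_bounded_join n (X : set A) m : (forall x, X x -> S_pow n x) ->
  is_join X m -> S_pow n m.
Proof.
move=> Xn [ub lb]; apply/S_pow_prefE/lediv_anti; first exact: pref_le.
by apply: lb => x Xx; apply: pref_max (Xn x Xx) (ub x Xx).
Qed.

Lemma is_join_mul2l x (X : set A) m : X !=set0 -> is_join X m ->
  is_join [set x * z | z in X] (x * m).
Proof.
move=> [z0 Xz0] [ub lb]; split=> [_ [z Xz <-]|m' H].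
  exact/lediv_mul2l/ub.
have [p m'E] : lediv_l x m'.
  by apply: (@lediv_trans (x * z0)); [exact: lediv_mulr|apply: H; exists z0].
rewrite m'E; apply: lediv_mul2l; apply: lb => z Xz.
by apply: (lediv_cancel (v := x)); rewrite -m'E; apply: H; exists z.
Qed.

End GarsideNormalForms.

(** * Moebius inversion *)
Section MoebiusInversion.
Local Open Scope group_scope.
Implicit Types (d u v w x y z : A) (D : {fset A}) (n : nat) (f g : A -> R^o).

Lemma finite_min_expanders x : finite_set (min_expanders x).
Proof.
pose h y := xget 1 [set u | y = x * u].
apply: (@sub_finite_set _ _ (h @` [set y | S_pow (height x) y])); last first.
  exact/finite_image/finite_S_pow.
move=> u [[hu _] _]; exists (x * u); first by apply/height_leP => //; exact: height_gt0.
by rewrite /h; case: xgetP => [v _ /= /at_mulI -> //|/(_ u) /(_ erefl)].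
Qed.

(** The element [y] without the last factor of its normal form; it is 1 when
    that form has a single factor. *)
Definition last_cut y : A := pref (height y).-1 y.

Lemma graded_multiplesE x y : graded_multiples x y <->
  lediv_l x y /\ ((1 < height y)%N -> ~ lediv_l x (last_cut y)).
Proof.
split=> -[xy H]; split=> //.
  move=> h1 xl; apply: (H (height y).-1); first by lia.
  by rewrite prod_take_normal_form //; lia.
move=> j /andP [j1 jh]; rewrite prod_take_normal_form; last by lia.
move=> xj; apply: H; first by lia.
by apply: lediv_trans xj (pref_mono _ _); lia.
Qed.

(** A divisor of [y] of height at most [n] divides [pref n y], which would be a
    proper truncation of [y] if [y] had greater height. *)
Lemma graded_multiples_S_pow n x y : (0 < n)%N -> S_pow n x ->
  graded_multiples x y -> S_pow n y.
Proof.
move=> n0 xn [xy H]; apply/height_leP => //; rewrite leqNgt; apply/negP => nh.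
apply: (H n); first by rewrite n0.
by rewrite prod_take_normal_form ?(ltnW nh) //; apply: pref_max.
Qed.

Definition admissible x D : Prop :=
  [set` D] `<=` min_expanders x /\ has_join [set` D].

Definition min_expander_set x : {fset A} := fset_set (min_expanders x).

Lemma mem_min_expander_set x d : d \in min_expander_set x <-> min_expanders x d.
Proof.
rewrite in_fset_set; last exact: finite_min_expanders.
by split=> [/set_mem|/mem_set].
Qed.

Lemma fpowerset_min_expanders x D : D \in fpowerset (min_expander_set x) <->
  [set` D] `<=` min_expanders x.
Proof.
rewrite fpowersetE; split=> [/fsubsetP H d /H /mem_min_expander_set //|H].
by apply/fsubsetP => d dD; apply/mem_min_expander_set/H.
Qed.

Lemma moebiusE f x : moebius f x =
  (\sum_(D <- fpowerset (min_expander_set x) | `[< admissible x D >])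
     (-1) ^+ #|` D| * f (x * join [set` D])%g)%R.
Proof.
rewrite bigfs //; first by apply: eq_fsbigl; apply/seteqP; split=> D /= /asboolP.
by move=> D /asboolP [/fpowerset_min_expanders ->].
Qed.

Lemma inv_moebiusE n f x : (0 < n)%N -> S_pow n x -> inv_moebius f x =
  (\sum_(y <- fset_set [set y | S_pow n y] | `[< graded_multiples x y >]) f y)%R.
Proof.
move=> n0 xn; rewrite bigfs //; first by apply: eq_fsbigl; apply/seteqP; split=> y /= /asboolP.
move=> y /asboolP /(graded_multiples_S_pow n0 xn) yn; rewrite in_fset_set; last exact: finite_S_pow.
by move=> /negP; case; apply/mem_set.
Qed.

Lemma moebius_linear : linear (@moebius Sigma ell R).
Proof.
move=> c f g; apply/funext => x.
rewrite -[RHS]/(c * moebius f x + moebius g x)%R !moebiusE mulr_sumr -big_split.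
by apply: eq_bigr => D _; rewrite -[X in (_ * X)%R]/(c * f _ + g _)%R mulrDr mulrCA.
Qed.

Lemma inv_moebius_linear : linear (@inv_moebius Sigma ell R).
Proof.
move=> c f g; apply/funext => x.
rewrite -[RHS]/(c * inv_moebius f x + inv_moebius g x)%R.
rewrite !(inv_moebiusE _ (height_gt0 x) (S_pow_height x)) mulr_sumr -big_split.
by apply: eq_bigr.
Qed.

Definition all_below x w D : Prop := forall d, d \in D -> lediv_l (x * d) w.

Lemma has_join_below x w D : lediv_l x w ->
  (has_join [set` D] /\ lediv_l (x * join [set` D]) w) <-> all_below x w D.
Proof.
move=> [p wE]; split=> [[/joinP [ub _] jw] d dD|H].
  by apply: lediv_trans jw; apply: lediv_mul2l; apply: ub.
have Hp d : [set` D] d -> lediv_l d p.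
  by move=> dD; apply: (lediv_cancel (v := x)); rewrite -wE; apply: H.
have hj := bounded_join Hp; split=> //; rewrite wE; apply: lediv_mul2l.
by case: (joinP hj) => _; apply.
Qed.

Lemma admissible_graded x y D : [set` D] `<=` min_expanders x -> lediv_l x y ->
  admissible x D /\ graded_multiples (x * join [set` D]) y <->
  all_below x y D /\ ((1 < height y)%N -> lediv_l x (last_cut y) -> ~ all_below x (last_cut y) D).
Proof.
move=> Dx xy; split=> [[[_ hj] /graded_multiplesE [jy H]]|[By H]].
  split; first exact/(has_join_below D xy).
  by move=> h1 xl /(has_join_below D xl) [_ /(H h1)].
have [hj jy] := (has_join_below D xy).2 By.
split=> //; apply/graded_multiplesE; split=> // h1 jl.
have xl : lediv_l x (last_cut y) by apply: lediv_trans jl; exact: lediv_mulr.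
by apply: (H h1 xl); apply/(has_join_below D xl).
Qed.

Lemma all_below_toggle x w d D : lediv_l (x * d) w ->
  all_below x w (toggle d D) <-> all_below x w D.
Proof.
move=> dw; rewrite /toggle; case: ifP => dD; split=> H e.
- by move=> eD; have [->//|ed] := eqVneq e d; apply: H; rewrite in_fsetD1 ed.
- by rewrite in_fsetD1 => /andP [_ eD]; apply: H.
- by move=> eD; apply: H; rewrite in_fset1U eD orbT.
- by rewrite in_fset1U => /orP [/eqP ->//|eD]; apply: H.
Qed.

Lemma min_expander_exists x w : lediv_l x w -> w <> x -> S_pow (height x) w ->
  exists2 d, min_expanders x d & lediv_l (x * d) w.
Proof.
move=> [u wE] wx wn.
have ux : expanders x u.
  split; first by rewrite -wE; apply/height_leP => //; exact: height_gt0.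
  by move=> u1; apply: wx; rewrite wE u1 mulg1.
pose Q n := exists v, [/\ expanders x v, lediv_l v u & at_len v = n].
have exQ : exists n, `[< Q n >].
  by exists (at_len u); apply/asboolP; exists u; split=> //; exact: lediv_refl.
have [n /asboolP [v [xv vu <-]] nmin] := ex_minnP exQ.
exists v; last by rewrite wE; exact: lediv_mul2l.
split=> // v' xv' v'v; apply: lediv_len_eq => //; apply: nmin; apply/asboolP.
by exists v'; split=> //; exact: lediv_trans vu.
Qed.

Lemma admissible_S_pow x D : admissible x D -> S_pow (height x) (x * join [set` D]).
Proof.
move=> [Dx hj]; have [[d dD]|D0] := pselect (exists d, d \in D).
  have Dn0 : [set` D] !=set0 by exists d.
  apply: S_pow_bounded_join (is_join_mul2l x Dn0 (joinP hj)).
  by move=> _ [v vD <-]; apply/height_leP; [exact: height_gt0|case: (Dx v vD) => -[]].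
have -> : join [set` D] = 1; last by rewrite mulg1; exact: S_pow_height.
by apply: lediv1_eq; case: (joinP hj) => _; apply=> d dD; case: D0; exists d.
Qed.

Lemma S_pow_last_cut n y : (1 < height y)%N -> S_pow n y -> S_pow n (last_cut y).
Proof.
move=> h1 yn; have n0 : (0 < n)%N.
  rewrite lt0n; apply/eqP => n0; rewrite n0 in yn.
  have : S_pow 1 y by apply: S_pow_widen yn.
  by move/height_leP => /(_ isT); lia.
by apply: (S_pow_widen (n := (height y).-1)); [move/height_leP: yn => /(_ n0); lia|exact: S_pow_pref].
Qed.

(** The condition on [D] says that [D] lies in the set of minimal expanders [d]
    with [x * d] dividing [y], and not in the smaller one for [last_cut y]. An
    element of the smaller set can be toggled freely, or, when [x] does not
    divide [last_cut y], an element of the larger one. The smaller set is not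
    empty: [last_cut y] has height less than that of [y], hence less than that
    of [x], so it differs from [x]. *)
Lemma moebius_coef x y : S_pow (height x) y ->
  (\sum_(D <- fpowerset (min_expander_set x) |
      `[< admissible x D /\ graded_multiples (x * join [set` D])%g y >])
     (-1) ^+ #|` D| = (y == x)%:R :> R)%R.
Proof.
move=> yn; have [xy|nxy] := pselect (lediv_l x y); last first.
  rewrite big_pred0 => [|D].
    by case: eqP => // yx; case: nxy; rewrite yx; exact: lediv_refl.
  apply/asboolPn => -[_ [jy _]]; apply: nxy; apply: lediv_trans jy.
  exact: lediv_mulr.
have cE D : D \in fpowerset (min_expander_set x) ->
    `[< admissible x D /\ graded_multiples (x * join [set` D])%g y >] =
    `[< all_below x y D /\ ((1 < height y)%N -> lediv_l x (last_cut y) ->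
          ~ all_below x (last_cut y) D) >].
  by move=> /fpowerset_min_expanders Dx; apply: asbool_equiv_eq; apply: admissible_graded.
have [yx|/eqP yx] := eqVneq y x.
  subst y; have c0 D : D \in fpowerset (min_expander_set x) ->
      `[< admissible x D /\ graded_multiples (x * join [set` D])%g x >] = (D == fset0).
    move=> DP; rewrite cE //; apply/asboolP/eqP => [[xD _]|->]; last first.
      split=> [d|h1 xl]; first by rewrite inE.
      have : S_pow (height x).-1 x.
        rewrite {2}(lediv_anti xl (pref_le _ _)); exact: S_pow_pref.
      by move=> /height_leP; lia.
    apply/eqP; rewrite -fsubset0; apply/fsubsetP => d dD.
    have /lediv1_eq d1 : lediv_l d 1 by apply: (lediv_cancel (v := x)); rewrite mulg1; apply: xD.
    by move: DP => /fpowerset_min_expanders /(_ d dD) [[_ []]].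
  rewrite big_mkcond (bigD1_seq fset0) ?fset_uniq ?fpowersetE ?fsub0set //=.
  rewrite c0 ?fpowersetE ?fsub0set // eqxx expr0 big_seq_cond big1 ?addr0 //.
  by move=> D /andP [DP /negbTE D0]; rewrite c0 // D0.
have [e xe [ey elast]] : exists2 d, min_expanders x d & lediv_l (x * d) y /\
    ((1 < height y)%N -> lediv_l x (last_cut y) -> lediv_l (x * d) (last_cut y)).
  have [[h1 xl]|H] := pselect ((1 < height y)%N /\ lediv_l x (last_cut y)).
    have lx : last_cut y <> x.
      move=> lx; have : S_pow (height y).-1 x by rewrite -lx; exact: S_pow_pref.
      move/height_leP; have /height_leP := yn; have := height_gt0 x; lia.
    have [d xd dl] := min_expander_exists xl lx (S_pow_last_cut h1 yn).
    by exists d => //; split=> //; apply: lediv_trans dl _; exact: pref_le.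
  have [d xd dy] := min_expander_exists xy yx yn.
  by exists d => //; split=> // h1 xl; case: H.
apply: (@sum_sign_toggle _ _ e); first exact/mem_min_expander_set.
move=> D DP; rewrite !cE ?toggle_fpowerset //; last exact/mem_min_expander_set.
apply: asbool_equiv_eq; rewrite all_below_toggle //.
by split=> -[By H]; split=> // h1 xl; have := H h1 xl; rewrite all_below_toggle //; apply: elast.
Qed.

Lemma inv_moebiusK : cancel (@inv_moebius Sigma ell R) (@moebius Sigma ell R).
Proof.
move=> f; apply/funext => x; pose n := height x.
have n0 : (0 < n)%N := height_gt0 x.
rewrite moebiusE; pose Y := fset_set [set y : A | S_pow n y].
have YE y : (y \in Y) = `[< S_pow n y >] by rewrite in_fset_set //; exact: finite_S_pow.
transitivity (\sum_(D <- fpowerset (min_expander_set x) | `[< admissible x D >])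
    \sum_(y <- Y | `[< graded_multiples (x * join [set` D])%g y >])
      ((-1) ^+ #|` D| * f y))%R.
  apply: eq_bigr => D /asboolP aD; rewrite (inv_moebiusE _ n0) ?mulr_sumr //.
  exact: admissible_S_pow.
rewrite (exchange_big_dep predT) //=.
rewrite (eq_big_seq (fun y => (y == x)%:R * f y)%R) => [|y].
  rewrite (bigD1_seq x) ?fset_uniq ?YE //=; last by apply/asboolP; exact: S_pow_height.
  rewrite eqxx mul1r big1 ?addr0 // => y /negbTE ->.
  by rewrite mul0r.
rewrite YE => /asboolP yn; rewrite -moebius_coef // mulr_suml.
by apply: eq_bigl => D; apply/andP/asboolP => [[/asboolP ? /asboolP ?]|[? ?]] //;
  split; apply/asboolP.
Qed.

(** All terms other than [f x] in the transform at [x] are values of [f] at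
    proper multiples of [x] of height at most that of [x]; descending induction
    on the length inside a finite set recovers [f]. *)
Lemma moebius_inj f g : moebius f = moebius g -> f = g.
Proof.
move=> fg; apply/funext => x0; pose n := height x0.
have n0 : (0 < n)%N := height_gt0 x0.
pose N := (\max_(y <- fset_set [set y : A | S_pow n y]) at_len y)%N.
have lenN y : S_pow n y -> (at_len y <= N)%N.
  move=> yn; apply: (leq_bigmax_seq (F := at_len)) => //.
  by rewrite in_fset_set; [apply/mem_set|exact: finite_S_pow].
suff H x : S_pow n x -> f x = g x by apply: H; exact: S_pow_height.
have [k] := ubnP (N - at_len x)%N; elim: k x => // k IH x xk xn.
have := congr1 (fun h => h x) fg; rewrite /= !moebiusE.
have P0 : fset0 \in fpowerset (min_expander_set x) by rewrite fpowersetE fsub0set.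
have j0 : is_join [set` (fset0 : {fset A})] (1 : A).
  by split=> [d|m _]; [rewrite /= inE|exact: lediv1].
have hj0 : has_join [set` (fset0 : {fset A})] by exists 1.
have a0 : admissible x fset0 by split=> // d; rewrite /= inE.
have jE : join [set` (fset0 : {fset A})] = (1 : A).
  case: (joinP hj0) => _ lb; apply: lediv1_eq; apply: lb => d; by rewrite /= inE.
rewrite big_mkcond [in X in _ = X -> _]big_mkcond.
rewrite (bigD1_seq fset0) ?fset_uniq //= [in X in _ = X -> _](bigD1_seq fset0) ?fset_uniq //=.
have -> : `[< admissible x fset0 >] = true by apply/asboolP.
rewrite expr0 !mul1r jE mulg1.
set s1 := (\sum_(i <- _ | _) _)%R; set s2 := (\sum_(i <- _ | _) _)%R.
suff -> : s1 = s2 by move=> /addIr.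
apply: eq_bigr => D D0; case: ifP => // /asboolP aD; congr (_ * _)%R.
have [d dD] : exists d, d \in D by apply/fset0Pn.
have [Dx hj] := aD; have [ub _] := joinP hj.
have yn : S_pow n (x * join [set` D]).
  by apply: S_pow_widen (admissible_S_pow aD); apply/height_leP.
apply: IH => //; have := lenN _ yn; rewrite at_lenM.
have : at_len (join [set` D]) <> 0%N.
  move=> /at_len_eq0 j1; have := ub d dD; rewrite j1 => /lediv1_eq d1.
  by have [[_ ]] := Dx d dD.
by move: xk; lia.
Qed.

Lemma moebiusK : cancel (@moebius Sigma ell R) (@inv_moebius Sigma ell R).
Proof. by move=> f; apply: moebius_inj; rewrite inv_moebiusK. Qed.

End MoebiusInversion.

End ArtinTits.

Theorem theorem2p23 (R : realType) (Sigma : finType)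
    (ell : Sigma -> Sigma -> option nat)
    (Sigma_nonempty : (0 < #|Sigma|)%N)
    (ell_sym : forall a b, ell a b = ell b a)
    (ell_ge2 : forall a b n, ell a b = Some n -> (2 <= n)%N) :
  [/\ linear (@moebius Sigma ell R), linear (@inv_moebius Sigma ell R),
      cancel (@moebius Sigma ell R) (@inv_moebius Sigma ell R)
    & cancel (@inv_moebius Sigma ell R) (@moebius Sigma ell R)].
Proof.
split.
- exact: moebius_linear.
- exact: inv_moebius_linear.
- exact: moebiusK.
- exact: inv_moebiusK.
Qed.
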